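(* Let $\mathcal{A}=\{(1,1,1,0),(1,1,0,1),(1,0,1,1),(0,1,1,1),(2,1,0,0),(1,2,0,0),(0,0,2,1),(0,0,1,2)\}$, with its points labeled $a,b,c,d,e,f,g,h$ in this order. Then $\mathcal{A}$ is the vertex set of a $3$-dimensional lattice polytope of normalized volume $7$. This polytope has $70$ regular triangulations in $14$ symmetry classes under the action of $(\mathbb{Z}/2\mathbb{Z})^3$. Unimodular triangulations occur for $53$ of the $70$ triangulations. They come in $10$ symmetry classes, with the following orbit sizes, Stanley--Reisner ideals, representative weights and GKZ vectors: 1. orbit size $1$: $\langle ah, bg, cf, de, eg, eh, fg, fh \rangle$; weights $(4,1,7,2,9,5,9,9)$; GKZ vector $(5,5,5,5,2,2,2,2)$. 2. orbit size $4$: $\langle ab, ac, ah, cd, cf, eh, fg, fh \rangle$; weights $(5,2,8,4,2,9,5,9)$; GKZ vector $(2,5,2,5,5,2,5,2)$. 3. orbit size $4$: $\langle ab, ah, bg, cf, eg, eh, fg, fh \rangle$; weights $(8,3,1,1,4,9,6,9)$; GKZ vector $(3,3,5,7,4,2,2,2)$. 4. orbit size $4$: $\langle ab, ac, ah, bc, bg, cf, fg, fh, egh \rangle$; weights $(9,9,6,1,4,8,8,5)$; GKZ vector $(2,2,3,7,6,2,3,3)$. 5. orbit size $4$: $\langle ab, ac, ad, ah, bc, cd, cf, fh, bfg, deh\rangle$; weights $(7,3,9,1,2,4,1,9)$; GKZ vector $(1,4,1,4,6,3,6,3)$. 6. orbit size $4$: $\langle ab, ac, ad, ah, bc, bd,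 bg, cf, egh, fgh \rangle$; weights $(8,8,2,6,1,6,3,7)$; GKZ vector $(1,1,3,5,6,4,4,4)$. 7. orbit size $8$: $\langle ab, ac, ah, bg, cf, eh, fg, fh \rangle$; weights $(4,2,4,1,3,8,4,4)$; GKZ vector $(2,3,4,7,5,2,3,2)$. 8. orbit size $8$: $\langle ab, ac, ad, ah, bg, cf, eh, fh \rangle$; weights $(4,4,3,1,1,1,1,7)$; GKZ vector $(1,3,4,6,5,3,4,2)$. 9. orbit size $8$: $\langle ab, ac, ad, ah, cd, cf, eh, fh, bfg \rangle$; weights $(9,3,8,4,3,9,2,9)$; GKZ vector $(1,5,2,4,5,3,6,2)$. 10. orbit size $8$: $\langle ab, ac, ad, ah, bc, bg, cf, fh, egh \rangle$; weights $(9,9,4,3,4,7,3,8)$; GKZ vector $(1,2,3,6,6,3,4,3)$.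
   Context: The points of $\mathcal{A}$ are the exponent vectors, with respect to variables $x,y,z,w$, of the monomials $xyz,xyw,xzw,yzw,x^2y,xy^2,z^2w,zw^2$ (in the order $a,\dots,h$). The polytope is the convex hull ${\rm conv}(\mathcal{A})$. The action of $(\mathbb{Z}/2\mathbb{Z})^3$ is that of the symmetry group of ${\rm conv}(\mathcal{A})$, which the paper states to be isomorphic to $(\mathbb{Z}/2\mathbb{Z})^3$; it acts by permuting the coordinates $x,y,z,w$. Triangulations use only vertices from $\mathcal{A}$. Normalized volume is taken in the affine lattice of integer vectors with coordinate sum $3$, so that a unimodular lattice tetrahedron has volume $1$; a triangulation is unimodular if all its tetrahedra have normalized volume $1$. A triangulation is encoded by its Stanley--Reisner ideal in the variables $a,b,\dots,h$, the squarefree monomial ideal generated by the products of labels over the non-faces. A weight vector $\upsilon\in\mathbb{R}^8$ (coordinates in the order $a,\ldots,h$) induces a regular triangulation by lifting each point of $\mathcal{A}$ to its weight and projecting the lower faces; for unimodular triangulations the Stanley--Reisner ideal equals the initial ideal ${\rm in}_\upsilon(I_{\mathcal{A}})$, with respect to taking monomials of highest $\upsilon$-weight, of the toric ideal $I_{\mathcal{A}}$ of $\mathcal{A}$. The GKZ vector of a triangulation is the vector in $\mathbb{Z}^8$ whose coordinate at a point of $\mathcal{A}$ is the sum of the normalized volumes of the tetrahedra of the triangulation containing that point as a vertex.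
   Formalization: The symmetry group of the polytope acting by permuting x,y,z,w is not (Z/2Z)^3 as claimed but dihedral of order 8 (e.g. (x y) and (x z)(y w) do not commute); the symmetry classes and orbit sizes are stated for this actual group. *)

(* Defs.v *)
From mathcomp Require Import all_boot all_order all_fingroup all_algebra.
From mathcomp Require Import all_classical all_reals all_analysis.
(* Imported without its notations, which clash with mathcomp-analysis. *)
From mathcomp Require mpoly.
Import (canonicals) mpoly.

Set Implicit Arguments.
Unset Strict Implicit.
Unset Printing Implicit Defensive.

Import Order.TTheory GRing.Theory Num.Theory.
Local Open Scope ring_scope.

Definition exponents : seq (seq nat) :=
  [:: [:: 1; 1; 1; 0]; [:: 1; 1; 0; 1]; [:: 1; 0; 1; 1]; [:: 0; 1; 1; 1];
      [:: 2; 1; 0; 0]; [:: 1; 2; 0; 0]; [:: 0; 0; 2; 1]; [:: 0; 0; 1; 2]]%N.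

(* The labels a, ..., h are the elements 0, ..., 7 of 'I_8. *)
Definition expo (i : 'I_8) (j : 'I_4) : nat := nth 0%N (nth [::] exponents i) j.

Definition pt (R : realType) (i : 'I_8) : 'rV[R]_4 := \row_j (expo i j)%:R.

Definition dotv (R : realType) (u v : 'rV[R]_4) : R := \sum_j u 0 j * v 0 j.

(* conv { pt i | i \in s } *)
Definition hull (R : realType) (s : {set 'I_8}) : set 'rV[R]_4 :=
  [set x | exists c : 'I_8 -> R,
     [/\ forall i, 0 <= c i,
         \sum_(i in s) c i = 1
       & x = \sum_(i in s) c i *: pt R i]]%classic.
Arguments hull : clear implicits.

Definition polytope (R : realType) : set 'rV[R]_4 := hull R [set: 'I_8].
Arguments polytope : clear implicits.

(* Vertices are the 0-dimensional faces: the points that are the unique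
   maximizer over P of some linear functional. *)
Definition vertices (R : realType) (P : set 'rV[R]_4) : set 'rV[R]_4 :=
  [set v | P v /\ exists u : 'rV[R]_4,
     forall x, P x -> x <> v -> dotv u x < dotv u v]%classic.

(* The affine hull of P is p + V, with V of dimension d. *)
Definition has_dim (R : realType) (P : set 'rV[R]_4) (d : nat) : Prop :=
  exists (p : 'rV[R]_4) (V : {vspace 'rV[R]_4}),
    [/\ P p,
        forall x, P x -> x - p \in V,
        forall U : {vspace 'rV[R]_4},
          (forall x, P x -> x - p \in U) -> (V <= U)%VS
      & \dim V = d].

(* Forgetting w is a bijection from the hyperplane of coordinate sum 3 to R^3
   that maps its integer points onto Z^3. *)
Definition forget_w (R : realType) (v : 'rV[R]_4) : R * R * R :=
  (v 0 0, v 0 1, v 0 2%:R).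

(* Only meaningful for P contained in the hyperplane of coordinate sum 3; the
   image under forget_w of a unimodular tetrahedron has Lebesgue measure
   1/3!, hence the normalization. *)
Definition nvol (R : realType) (P : set 'rV[R]_4) : \bar R :=
  ((3`!)%:R%:E *
   ((@lebesgue_measure R \x @lebesgue_measure R) \x @lebesgue_measure R)
     (@forget_w R @` P)%classic)%E.

(* A triangulation is given by all its faces (the empty one included), each
   face by the set of labels of its vertices. *)
Definition aff_indep (R : realType) (s : {set 'I_8}) : Prop :=
  forall c : 'I_8 -> R,
    \sum_(i in s) c i = 0 -> \sum_(i in s) c i *: pt R i = 0 ->
    forall i, i \in s -> c i = 0.

Definition triangulation (R : realType) (T : {set {set 'I_8}}) : Prop :=
  [/\ forall s t : {set 'I_8}, s \in T -> t \subset s -> t \in T,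
      forall s, s \in T -> aff_indep R s,
      forall s t, s \in T -> t \in T ->
        (hull R s `&` hull R t)%classic = hull R (s :&: t)
    & (\bigcup_(s in [set` T]) hull R s)%classic = polytope R].

(* s is the label set of a lower face of the polytope lifted by w, i.e. of the
   face on which a functional (u, 1) of R^4 x R attains its minimum m (the
   empty face being obtained from a value m below the minimum). *)
Definition lower_face (R : realType) (w : 'I_8 -> R) (s : {set 'I_8}) : Prop :=
  exists (u : 'rV[R]_4) (m : R),
    forall i, m <= dotv u (pt R i) + w i ?= iff (i \in s).

Definition lower_faces (R : realType) (w : 'I_8 -> R) : {set {set 'I_8}} :=
  [set s : {set 'I_8} | `[< lower_face w s >]].

Definition regular_triangulations (R : realType) : {set {set {set 'I_8}}} :=
  [set T : {set {set 'I_8}} |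
    `[< triangulation R T /\ exists w : 'I_8 -> R, T = lower_faces w >]].

Definition unimodular (R : realType) (T : {set {set 'I_8}}) : Prop :=
  forall s : {set 'I_8}, s \in T -> #|s| = 4%N -> nvol (hull R s) = 1%E.

Definition unimodular_triangulations (R : realType) : {set {set {set 'I_8}}} :=
  [set T in regular_triangulations R | `[< unimodular R T >]].

Definition gkz (R : realType) (T : {set {set 'I_8}}) (j : 'I_8) : \bar R :=
  (\sum_(s in T | (#|s| == 4%N) && (j \in s)) nvol (hull R s))%E.

(* The permutations of the labels induced by the permutations of the
   coordinates x, y, z, w that preserve the set of points pt R i, hence the
   polytope.  They form a dihedral group of order 8, which is not
   isomorphic to (Z/2)^3. *)
Definition sym_set : {set {perm 'I_8}} :=
  [set p : {perm 'I_8} | [exists s : 'S_4,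
     [forall i, [forall j, expo (p i) j == expo i (s j)]]]].

Lemma sym_set_group : group_set sym_set.
Proof.
apply/group_setP; split=> [|p q].
  rewrite inE; apply/existsP; exists 1%g.
  by apply/forallP=> i; apply/forallP=> j; rewrite !perm1.
rewrite !inE => /existsP[s /forallP hp] /existsP[t /forallP hq].
apply/existsP; exists (t * s)%g; apply/forallP=> i; apply/forallP=> j.
rewrite !permM; have /forallP/(_ j)/eqP -> := hq (p i).
by have /forallP/(_ (t j)) := hp i.
Qed.

Canonical sym_group : {group {perm 'I_8}} := Group sym_set_group.

Definition sym_orbit (T : {set {set 'I_8}}) : {set {set {set 'I_8}}} :=
  orbit ('P^*^*)%act sym_group T.

Definition sym_classes (X : {set {set {set 'I_8}}}) :
    {set {set {set {set 'I_8}}}} :=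
  [set sym_orbit T | T in X].

Definition ideal_gen (A : comNzRingType) (S : set A) : set A :=
  [set p | exists (n : nat) (c g : 'I_n -> A),
     (forall i, S (g i)) /\ p = \sum_i c i * g i]%classic.

Definition sqfree_monomial (K : fieldType) (s : {set 'I_8}) :
    mpoly.mpoly 8 K :=
  \prod_(i in s) mpoly.mpolyX K (mpoly.mnm1 i).

Definition sr_ideal (K : fieldType) (T : {set {set 'I_8}}) :
    set (mpoly.mpoly 8 K) :=
  ideal_gen [set sqfree_monomial K s | s in [set s | s \notin T]]%classic.
Arguments sr_ideal : clear implicits.

Definition monomial_ideal (K : fieldType) (l : seq {set 'I_8}) :
    set (mpoly.mpoly 8 K) :=
  ideal_gen [set sqfree_monomial K s | s in [set` l]]%classic.
Arguments monomial_ideal : clear implicits.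

Record class_data := ClassData {
  orbit_size : nat;
  sr_generators : seq {set 'I_8};
  weights : seq nat;
  gkz_coords : seq nat
}.

Definition class_table : 10.-tuple class_data :=
  let a : 'I_8 := Ordinal (isT : 0 < 8)%N in
  let b : 'I_8 := Ordinal (isT : 1 < 8)%N in
  let c : 'I_8 := Ordinal (isT : 2 < 8)%N in
  let d : 'I_8 := Ordinal (isT : 3 < 8)%N in
  let e : 'I_8 := Ordinal (isT : 4 < 8)%N in
  let f : 'I_8 := Ordinal (isT : 5 < 8)%N in
  let g : 'I_8 := Ordinal (isT : 6 < 8)%N in
  let h : 'I_8 := Ordinal (isT : 7 < 8)%N in
  [tuple
    ClassData 1
      [:: [set a; h]; [set b; g]; [set c; f]; [set d; e]; [set e; g];
          [set e; h]; [set f; g]; [set f; h]]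
      [:: 4; 1; 7; 2; 9; 5; 9; 9] [:: 5; 5; 5; 5; 2; 2; 2; 2];
    ClassData 4
      [:: [set a; b]; [set a; c]; [set a; h]; [set c; d]; [set c; f];
          [set e; h]; [set f; g]; [set f; h]]
      [:: 5; 2; 8; 4; 2; 9; 5; 9] [:: 2; 5; 2; 5; 5; 2; 5; 2];
    ClassData 4
      [:: [set a; b]; [set a; h]; [set b; g]; [set c; f]; [set e; g];
          [set e; h]; [set f; g]; [set f; h]]
      [:: 8; 3; 1; 1; 4; 9; 6; 9] [:: 3; 3; 5; 7; 4; 2; 2; 2];
    ClassData 4
      [:: [set a; b]; [set a; c]; [set a; h]; [set b; c]; [set b; g];
          [set c; f]; [set f; g]; [set f; h]; [set e; g; h]]
      [:: 9; 9; 6; 1; 4; 8; 8; 5] [:: 2; 2; 3; 7; 6; 2; 3; 3];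
    ClassData 4
      [:: [set a; b]; [set a; c]; [set a; d]; [set a; h]; [set b; c];
          [set c; d]; [set c; f]; [set f; h]; [set b; f; g]; [set d; e; h]]
      [:: 7; 3; 9; 1; 2; 4; 1; 9] [:: 1; 4; 1; 4; 6; 3; 6; 3];
    ClassData 4
      [:: [set a; b]; [set a; c]; [set a; d]; [set a; h]; [set b; c];
          [set b; d]; [set b; g]; [set c; f]; [set e; g; h]; [set f; g; h]]
      [:: 8; 8; 2; 6; 1; 6; 3; 7] [:: 1; 1; 3; 5; 6; 4; 4; 4];
    ClassData 8
      [:: [set a; b]; [set a; c]; [set a; h]; [set b; g]; [set c; f];
          [set e; h]; [set f; g]; [set f; h]]
      [:: 4; 2; 4; 1; 3; 8; 4; 4] [:: 2; 3; 4; 7; 5; 2; 3; 2];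
    ClassData 8
      [:: [set a; b]; [set a; c]; [set a; d]; [set a; h]; [set b; g];
          [set c; f]; [set e; h]; [set f; h]]
      [:: 4; 4; 3; 1; 1; 1; 1; 7] [:: 1; 3; 4; 6; 5; 3; 4; 2];
    ClassData 8
      [:: [set a; b]; [set a; c]; [set a; d]; [set a; h]; [set c; d];
          [set c; f]; [set e; h]; [set f; h]; [set b; f; g]]
      [:: 9; 3; 8; 4; 3; 9; 2; 9] [:: 1; 5; 2; 4; 5; 3; 6; 2];
    ClassData 8
      [:: [set a; b]; [set a; c]; [set a; d]; [set a; h]; [set b; c];
          [set b; g]; [set c; f]; [set f; h]; [set e; g; h]]
      [:: 9; 9; 4; 3; 4; 7; 3; 8] [:: 1; 2; 3; 6; 6; 3; 4; 3]
  ]%N.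

Definition weight (R : realType) (k : 'I_10) (j : 'I_8) : R :=
  (nth 0%N (weights (tnth class_table k)) j)%:R.

(* Main.v *)
Require Import Defs.
From HB Require Import structures.
From mathcomp Require Import all_boot all_order all_fingroup all_algebra.
From mathcomp Require Import all_classical all_reals all_analysis.
From mathcomp Require Import measurable_realfun.
From mathcomp Require mpoly.
Import (canonicals) mpoly.
From mathcomp Require Import ring lra.

(** The points of the configuration lie on the plane of coordinate sum 3, so their
    affine dependences are linear ones, and every question about a weight [w]
    is decided by the signs of the pairings of [w] with the circuits, the
    support-minimal integer dependences: 26 vectors up to sign.

    Lifting by [w] and pairing with a circuit [l] gives the sum of [l i] times
    the height of the lifted point [i] above a supporting hyperplane.  Hence if
    the pairing is positive, no lower face contains the positive support of
    [l] ([lower_face_circuit]).  The complex of all sets that contain no such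
    support is, for the weights used here, exactly the complex of lower faces
    ([complex_lower_faces]): a maximal face is a basis, which determines a
    unique functional, and the heights of the other points above it are
    pairings with circuits.  These faces cover the polytope
    ([complex_cover]), because a representation of a point as a convex
    combination that minimizes the weight cannot be improved along a circuit,
    which says that its support is a face; so they form a triangulation.

    That there are no others ([regular_from_list]) is a finite search.  For a
    real weight [w], orient each circuit so that its pairing with [w] is
    positive, zeros being decided by a second, generic weight.  The 26 signs
    satisfy every relation that comes from a positive dependence between three
    oriented circuits.  An exhaustive search through the sign vectors allowed
    by these relations shows that the resulting non-faces always include all
    non-faces of a complex given by one of 112 explicit weights, the orbits of
    14 representatives.  A regular triangulation given by [w] is therefore
    contained in a known one, and a triangulation contained in another equals
    it ([triangulation_sub_eq]), since a barycenter of a face has to be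
    covered.  Orbits, cardinalities and non-faces are then compared by
    evaluation, each complex being encoded by the 256 truth values of its
    membership predicate.

    Volumes come from Fubini's theorem: it gives the effect on measure of the
    maps that change one coordinate by an affine function of all, hence of the
    affine maps that factor into three of these ([affine3_image]), and it
    reduces the standard simplex to integrals of powers ([vol_simplex]).  The
    normalized volume of a tetrahedron is then a determinant, and the volume
    of the polytope is the sum over the facets of a triangulation, whose
    relative interiors are disjoint and have full measure. *)

Set Implicit Arguments.
Unset Strict Implicit.
Unset Printing Implicit Defensive.

Import Order.TTheory GRing.Theory Num.Theory.
Import numFieldNormedType.Exports.
Local Open Scope ring_scope.

(** * Integer data and their evaluation *)

Definition expz (k j : nat) : int := (nth 0%N (nth [::] exponents k) j)%:Z.

Definition dot (u v : seq int) : int :=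
  foldr (fun k z => u`_k * v`_k + z) 0 (iota 0 8).

(** Each is the vector of signed 4 by 4 minors of five of the points, made
    primitive; one is listed of each pair of opposite circuits. *)
Definition circuits : seq (seq int) :=
  [:: [:: 0; 0; 0; 3; 1; -2; -1; -1]; [:: 0; 0; 1; -1; -1; 1; 0; 0];
      [:: 0; 0; 1; 2; 0; -1; -1; -1]; [:: 0; 0; 2; 1; -1; 0; -1; -1];
      [:: 0; 0; 3; 0; -2; 1; -1; -1]; [:: 0; 1; -2; 0; 1; -1; 1; 0];
      [:: 0; 1; -1; -1; 0; 0; 1; 0]; [:: 0; 1; 0; -2; -1; 1; 1; 0];
      [:: 0; 1; 0; 1; 0; -1; 0; -1]; [:: 0; 1; 1; 0; -1; 0; 0; -1];
      [:: 0; 2; -1; 0; 0; -1; 1; -1]; [:: 0; 2; 0; -1; -1; 0; 1; -1];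
      [:: 0; 3; 0; 0; -1; -1; 1; -2]; [:: 1; -1; 0; 0; 0; 0; -1; 1];
      [:: 1; 0; -2; 0; 1; -1; 0; 1]; [:: 1; 0; -1; -1; 0; 0; 0; 1];
      [:: 1; 0; 0; -2; -1; 1; 0; 1]; [:: 1; 0; 0; 1; 0; -1; -1; 0];
      [:: 1; 0; 1; 0; -1; 0; -1; 0]; [:: 1; 1; -1; 0; 0; -1; 0; 0];
      [:: 1; 1; 0; -1; -1; 0; 0; 0]; [:: 1; 2; 0; 0; -1; -1; 0; -1];
      [:: 2; 0; -1; 0; 0; -1; -1; 1]; [:: 2; 0; 0; -1; -1; 0; -1; 1];
      [:: 2; 1; 0; 0; -1; -1; -1; 0]; [:: 3; 0; 0; 0; -1; -1; -2; 1]].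

Definition opp_vec (l : seq int) : seq int := [seq - x | x <- l].

Definition signed_circuits : seq (seq int) := circuits ++ map opp_vec circuits.

Definition orient (k : nat) (b : bool) : seq int :=
  let l := nth [::] circuits k in if b then l else opp_vec l.

Definition pos_support (l : seq int) : bitseq := [seq 0 < x | x <- l].

(** The boolean connectives are functions, so under call-by-value evaluation
    [has] visits the whole list; the explicit conditional stops early, which
    the exhaustive searches below depend on. *)
Fixpoint has_lazy (T : Type) (a : pred T) (s : seq T) : bool :=
  if s is x :: s' then if a x then true else has_lazy a s' else false.

Lemma has_lazyE (T : Type) (a : pred T) (s : seq T) : has_lazy a s = has a s.
Proof. by elim: s => //= x s ->; case: (a x). Qed.

Fixpoint submask (m n : bitseq) : bool :=
  match m, n with
  | b :: m', c :: n' => if (if b then c else true) then submask m' n' else false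
  | b :: m', [::] => if b then false else submask m' [::]
  | [::], _ => true
  end.

Fixpoint all_masks (n : nat) : seq bitseq :=
  if n is n'.+1 then
    let r := all_masks n' in map (cons true) r ++ map (cons false) r
  else [:: [::]].
Definition masks : seq bitseq := all_masks 8.

(** [M] lists forbidden masks, in practice the non-faces of a complex. *)
Definition face (M : seq bitseq) (m : bitseq) : bool :=
  ~~ has_lazy (submask^~ m) M.

(** The sets that [w] forbids: a circuit is a binomial of the toric ideal, and
    when [w] pairs positively with it, its leading monomial is the positive
    part. *)
Definition nonfaces (w : seq int) : seq bitseq :=
  [seq pos_support l | l <- signed_circuits & 0 < dot w l].

(** Two complexes are equal if and only if their codes are, and codes can be
    compared by evaluation. *)
Definition code (M : seq bitseq) : bitseq := [seq face M m | m <- masks].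

Definition support (m : bitseq) : seq nat :=
  [seq k <- iota 0 8 | nth false m k].

Definition det3 (x y z : seq int) : int :=
  x`_0 * (y`_1 * z`_2 - y`_2 * z`_1) - x`_1 * (y`_0 * z`_2 - y`_2 * z`_0)
  + x`_2 * (y`_0 * z`_1 - y`_1 * z`_0).

Definition dot4 (u : seq int) (i : nat) : int :=
  foldr (fun j z => u`_j * expz i j + z) 0 (iota 0 4).

Definition cross4 (i j k : nat) : seq int :=
  [seq (-1) ^+ c * det3 [seq expz i d | d <- iota 0 4 & d != c]
                        [seq expz j d | d <- iota 0 4 & d != c]
                        [seq expz k d | d <- iota 0 4 & d != c]
     | c <- iota 0 4].

(** The generalized cross product of the other three points of [b] vanishes on
    them; it is nonzero on [i] exactly when [b] is a basis. *)
Definition dualvec (b : bitseq) (i : nat) : seq int :=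
  let r := [seq k <- support b | k != i] in
  cross4 (nth 0%N r 0) (nth 0%N r 1) (nth 0%N r 2).

Definition is_basis (b : bitseq) : bool :=
  (size (support b) == 4%N) &&
  all (fun i => all (fun j => (dot4 (dualvec b i) j != 0) == (i == j))
                    (support b)) (support b).

Definition bases : seq bitseq := [seq b <- masks | is_basis b].

Definition pure (B M : seq bitseq) : bool :=
  let F := [seq b <- B | face M b] in
  all (fun m => if face M m then has_lazy (submask m) F else true) masks.

(** The two conditions under which [nonfaces w] describes the lower faces.
    Pairings with circuits may vanish, as they do for some weights of the
    table, provided that neither side of such a circuit is a face. *)
Definition admissible (B : seq bitseq) (w : seq int) : bool :=
  let M := nonfaces w in
  all (fun l => (dot w l == 0) ==> ~~ face M (pos_support l)) signed_circuits
  && pure B M.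

Definition circuits_ok : bool :=
  all (fun l => [&& size l == 8%N,
    all (fun j => dot l [seq expz i j | i <- iota 0 8] == 0) (iota 0 4),
    dot l (nseq 8 1) == 0,
    has (fun x => x != 0) l &
    all (fun x => `|x| <= 3) l]) signed_circuits.

(** Over a basis each further point has a fundamental circuit; its sign at that
    point is normalized to be positive. *)
Definition fundamental_ok : bool :=
  all (fun b => all (fun j => nth false b j ||
    has (fun l => (0 < l`_j) &&
      all (fun i => (l`_i != 0) ==> (nth false b i || (i == j))) (iota 0 8))
      signed_circuits) (iota 0 8)) bases.

Definition table_weights : seq (seq nat) :=
  [:: [:: 4; 1; 7; 2; 9; 5; 9; 9]; [:: 5; 2; 8; 4; 2; 9; 5; 9];
      [:: 8; 3; 1; 1; 4; 9; 6; 9]; [:: 9; 9; 6; 1; 4; 8; 8; 5];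
      [:: 7; 3; 9; 1; 2; 4; 1; 9]; [:: 8; 8; 2; 6; 1; 6; 3; 7];
      [:: 4; 2; 4; 1; 3; 8; 4; 4]; [:: 4; 4; 3; 1; 1; 1; 1; 7];
      [:: 9; 3; 8; 4; 3; 9; 2; 9]; [:: 9; 9; 4; 3; 4; 7; 3; 8]]%N.

(** Representatives of the four classes that are not unimodular. *)
Definition other_weights : seq (seq nat) :=
  [:: [:: 0; 1; 1; 2; 0; 1; 0; 0]; [:: 0; 1; 0; 1; 0; 1; 1; 0];
      [:: 0; 1; 1; 2; 1; 0; 1; 0]; [:: 0; 1; 1; 1; 0; 0; 0; 1]]%N.

Definition int_weights (w : seq nat) : seq int := [seq n%:Z | n <- w].

Definition unimodular_reps : seq (seq int) := map int_weights table_weights.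
Definition reps : seq (seq int) := unimodular_reps ++ map int_weights other_weights.

(** The label permutations induced by those coordinate permutations that map
    the configuration to itself; [index] returns 8 when they do not. *)
Definition sym_list : seq (seq nat) :=
  [seq q <- [seq [seq index [seq nth 0%N e (nth 0%N s j) | j <- iota 0 4]
                            exponents | e <- exponents]
            | s <- permutations (iota 0 4)]
   | all (fun i => (i < 8)%N) q].

Definition permute (T : Type) (x0 : T) (q : seq nat) (s : seq T) : seq T :=
  [seq nth x0 s k | k <- q].

Definition all_weights : seq (seq int) :=
  flatten [seq [seq permute 0 q w | q <- sym_list] | w <- reps].

Definition act_code (q : seq nat) (M : seq bitseq) : bitseq :=
  [seq face M (permute false q m) | m <- masks].

Definition orbit_codes (M : seq bitseq) : seq bitseq :=
  [seq act_code q M | q <- sym_list].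

(** Coefficients up to 3 suffice for the circuits at hand. *)
Definition dependent3 (x y z : seq int) : bool :=
  has_lazy (fun p : int => has_lazy (fun q : int => has_lazy (fun r : int =>
    ~~ has_lazy (fun k => p * x`_k + q * y`_k + r * z`_k != 0) (iota 0 8))
    [:: 1; 2; 3]) [:: 1; 2; 3]) [:: 1; 2; 3].

Definition signs (i n : nat) : seq (nat * bool) :=
  [seq (k, b) | k <- iota i n, b <- [:: true; false]].

(** Grouped by the largest index involved, so that the search below only
    consults the relations that its last choice completes. *)
Definition dependences_at (k : nat) : seq (nat * bool * (nat * bool) * bool) :=
  [seq t <- [seq (p, d) | p <- [seq (ib, jc) | ib <- signs 0 k,
                                  jc <- signs ib.1.+1 (k - ib.1.+1)],
                          d <- [:: true; false]]
   | dependent3 (orient t.1.1.1 t.1.1.2) (orient t.1.2.1 t.1.2.2) (orient k t.2)].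

Definition dependences : seq (seq (nat * bool * (nat * bool) * bool)) :=
  [seq dependences_at k | k <- iota 0 26].

(** A positive dependence between oriented circuits excludes that all three
    pair positively with a weight. *)
Definition conflict D (a : bitseq) : bool :=
  has (fun t => let: (ib, jc, d) := t in
     [&& nth false a ib.1 == ib.2, nth false a jc.1 == jc.2
       & nth false a (size a).-1 == d]) (nth [::] D (size a).-1).

(** All orientations are chosen; [L] lists the non-faces of the known
    complexes, one of which has to be forced. *)
Definition closed_leaf (L : seq (seq bitseq)) (a : bitseq) : bool :=
  let N := mkseq (fun k => pos_support (orient k (nth false a k))) 26 in
  has_lazy (fun M => ~~ has_lazy (face N) M) L.

Fixpoint explore D L (n : nat) (a : bitseq) : bool :=
  if n is n'.+1 then
    let try b :=
      if conflict D (rcons a b) then true else explore D L n' (rcons a b) in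
    try true && try false
  else closed_leaf L a.

(* Only evaluation needs the entries; unification must not unfold these lists. *)
Opaque circuits signed_circuits masks bases all_weights unimodular_reps reps.

(** * Masks and circuits *)

Lemma circuits_checked : circuits_ok. Proof. by vm_compute. Qed.

Lemma fundamental_checked : fundamental_ok. Proof. by vm_compute. Qed.

Lemma weights_checked : all (admissible bases) all_weights. Proof. by vm_compute. Qed.

Lemma dot_sum (R : pzRingType) (u v : seq int) :
  (dot u v)%:~R = \sum_(i < 8) (u`_i)%:~R * (v`_i)%:~R :> R.
Proof. by rewrite !big_ord_recl big_ord0 /= !rmorphD !rmorphM. Qed.

Lemma submaskP (m n : bitseq) :
  reflect (forall k, nth false m k -> nth false n k) (submask m n).
Proof.
elim: m n => [|b m IH] [|c n] /=; try by constructor => k; rewrite nth_nil.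
- case: b => /=; first by constructor => /(_ 0%N isT).
  apply: (iffP (IH _)) => [H [|k] //= /H|H k /(H k.+1)]; rewrite ?nth_nil //.
- case bc: (if b then c else true); last first.
    constructor => /(_ 0%N) /=; move: bc; case: b; case: c => // _.
    by move/(_ isT).
  apply: (iffP (IH _)) => [H [|k] //=|H k /(H k.+1)] //; last exact: H.
  by move=> bT; rewrite bT in bc.
Qed.

Lemma submask_trans : transitive submask.
Proof. by move=> n m p /submaskP mn /submaskP np; apply/submaskP=> k /mn/np. Qed.

Lemma faceP (M : seq bitseq) (m : bitseq) :
  reflect (forall n, n \in M -> ~~ submask n m) (face M m).
Proof. by rewrite /face has_lazyE -all_predC; apply: allP. Qed.

Lemma face_sub (M : seq bitseq) (m n : bitseq) :
  submask m n -> face M n -> face M m.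
Proof.
move=> mn /faceP Fn; apply/faceP => k /Fn; apply: contra => km.
exact: submask_trans mn.
Qed.

Lemma mem_all_masks (n : nat) (m : bitseq) : size m = n -> m \in all_masks n.
Proof.
elim: n m => [|n IH] [|b m] //= [/IH mn].
by rewrite mem_cat; case: b; rewrite (map_f (cons _)) ?orbT.
Qed.

Definition mask_of (s : {set 'I_8}) : bitseq :=
  mkseq (fun k => inord k \in s) 8.

Lemma nth_mask_of (s : {set 'I_8}) (i : 'I_8) :
  nth false (mask_of s) i = (i \in s).
Proof. by rewrite nth_mkseq ?ltn_ord // inord_val. Qed.

Lemma nth_maskW (s : {set 'I_8}) (k : nat) :
  nth false (mask_of s) k -> (k < 8)%N.
Proof.
by case: ltnP => // k8; rewrite nth_default // size_mkseq.
Qed.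

Lemma submask_of (s t : {set 'I_8}) :
  submask (mask_of s) (mask_of t) = (s \subset t).
Proof.
apply/submaskP/fintype.subsetP => [H i|H k sk].
  by rewrite -!nth_mask_of; apply: H.
have k8 := nth_maskW sk; move: sk.
by rewrite -[k]/(nat_of_ord (Ordinal k8)) !nth_mask_of; apply: H.
Qed.

Lemma mask_of_mask (s : {set 'I_8}) : mask_of s \in masks.
Proof. by apply: mem_all_masks; rewrite size_mkseq. Qed.

Definition set_of (m : bitseq) : {set 'I_8} := [set i : 'I_8 | nth false m i].

Lemma set_ofK (s : {set 'I_8}) : set_of (mask_of s) = s.
Proof. by apply/setP => i; rewrite inE nth_mask_of. Qed.

Lemma size_masks (m : bitseq) : m \in masks -> size m = 8%N.
Proof. 
have : all (fun m : bitseq => size m == 8%N) masks by vm_compute.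
by move/allP => H /H/eqP.
Qed.

Lemma mask_ofK (m : bitseq) : m \in masks -> mask_of (set_of m) = m.
Proof.
move=> /size_masks sm; apply: (@eq_from_nth _ false) => [|k].
  by rewrite size_mkseq sm.
by rewrite size_mkseq => k8; rewrite nth_mkseq // inE inordK.
Qed.

Definition complex (M : seq bitseq) : {set {set 'I_8}} :=
  [set s | face M (mask_of s)].

Lemma nth_pos_support (l : seq int) (k : nat) : nth false (pos_support l) k = (0 < l`_k).
Proof.
have [kl|lk] := ltnP k (size l); first by rewrite (nth_map 0).
by rewrite !nth_default ?size_map.
Qed.

Lemma pos_support_subP (l : seq int) (s : {set 'I_8}) : size l = 8%N ->
  reflect (forall i : 'I_8, 0 < l`_i -> i \in s) (submask (pos_support l) (mask_of s)).
Proof.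
move=> sl; apply: (iffP (submaskP _ _)) => H.
  by move=> i; rewrite -nth_pos_support -nth_mask_of; apply: H.
move=> k; rewrite nth_pos_support => lk; have [k8|k8] := ltnP k 8; last first.
  by move: lk; rewrite nth_default ?sl.
by rewrite -[k]/(nat_of_ord (Ordinal k8)) nth_mask_of H.
Qed.

Lemma nth_opp (l : seq int) (k : nat) : (opp_vec l)`_k = - l`_k.
Proof.
have [kl|lk] := ltnP k (size l); first by rewrite (nth_map 0).
by rewrite !nth_default ?oppr0 ?size_map.
Qed.

Lemma dot_opp (w l : seq int) : dot w (opp_vec l) = - dot w l.
Proof.
rewrite -[LHS]intz -[dot w l]intz !dot_sum -sumrN; apply: eq_bigr => i _.
by rewrite nth_opp rmorphN mulrN.
Qed.

Lemma oppK : involutive opp_vec.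
Proof. by move=> l; rewrite /opp_vec -map_comp map_id_in // => x _ /=; rewrite opprK. Qed.

Lemma signed_opp (l : seq int) :
  l \in signed_circuits -> opp_vec l \in signed_circuits.
Proof.
rewrite !mem_cat => /orP[lc|/mapP[l' lc ->]]; first by rewrite map_f ?orbT.
by rewrite oppK lc.
Qed.

Lemma circuitsP (l : seq int) : l \in signed_circuits ->
  [/\ size l = 8%N,
      forall j : 'I_4, \sum_(i < 8) l`_i * (expo i j)%:Z = 0,
      \sum_(i < 8) l`_i = 0,
      exists i : 'I_8, l`_i != 0
    & forall k, `|l`_k| <= 3].
Proof.
have /allP H := circuits_checked => /H /and5P[/eqP sl l4 l1 l0 l3].
have intsum F (u v : seq int) : (forall i : 'I_8, v`_i = F i) ->
    dot u v == 0 -> \sum_(i < 8) u`_i * F i = 0.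
  move=> vF /eqP; rewrite -[dot _ _]intz dot_sum => uv.
  by rewrite -[RHS]uv; apply: eq_bigr => i _; rewrite vF !intz.
split=> //.
- move=> j; have /allP/(_ j) := l4; rewrite mem_iota ltn_ord => /(_ isT).
  apply: intsum => i; rewrite (nth_map 0%N) ?size_iota //.
  by rewrite nth_iota.
- under eq_bigr => i _ do rewrite -[l`_i]mulr1.
  by apply: intsum l1 => i; rewrite nth_nseq ltn_ord.
- have /(has_nthP 0)[k k8 lk] := l0; rewrite sl in k8.
  by exists (Ordinal k8).
- move=> k; have [kl|lk] := ltnP k (size l); first by have /(all_nthP 0)->:= l3.
  by rewrite nth_default.
Qed.

Lemma circuit_pt (R : realType) (l : seq int) : l \in signed_circuits ->
  \sum_(i < 8) (l`_i)%:~R *: pt R i = 0.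
Proof.
case/circuitsP => _ lj _ _ _; apply/rowP => j; rewrite summxE mxE.
transitivity ((\sum_(i < 8) l`_i * (expo i j)%:Z)%:~R : R); last by rewrite lj.
rewrite rmorph_sum; apply: eq_bigr => i _.
by rewrite !mxE rmorphM /=.
Qed.

Lemma circuit_sum (R : realType) (l : seq int) : l \in signed_circuits ->
  \sum_(i < 8) (l`_i)%:~R = 0 :> R.
Proof.
case/circuitsP => _ _ l1 _ _; have := congr1 (fun z : int => z%:~R : R) l1.
by rewrite rmorph_sum.
Qed.

(** * Lower faces and circuits *)

Lemma dotv_sumr (R : realType) (I : finType) (P : pred I) (u : 'rV[R]_4)
    (c : I -> R) (v : I -> 'rV[R]_4) :
  dotv u (\sum_(i | P i) c i *: v i) = \sum_(i | P i) c i * dotv u (v i).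
Proof.
rewrite /dotv; under eq_bigr => j _ do rewrite summxE mulr_sumr.
rewrite exchange_big; apply: eq_bigr => i _; rewrite mulr_sumr.
by apply: eq_bigr => j _; rewrite mxE mulrCA.
Qed.

Lemma dotvC (R : realType) (u v : 'rV[R]_4) : dotv u v = dotv v u.
Proof. by apply: eq_bigr => j _; rewrite mulrC. Qed.

Lemma dotv_suml (R : realType) (I : finType) (P : pred I) (v : 'rV[R]_4)
    (c : I -> R) (u : I -> 'rV[R]_4) :
  dotv (\sum_(i | P i) c i *: u i) v = \sum_(i | P i) c i * dotv (u i) v.
Proof. by rewrite dotvC dotv_sumr; apply: eq_bigr => i _; rewrite dotvC. Qed.

Definition pairing (R : realType) (w : 'I_8 -> R) (l : seq int) : R :=
  \sum_(i < 8) (l`_i)%:~R * w i.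

Definition realw (R : realType) (w : seq int) (i : 'I_8) : R := (w`_i)%:~R.

Lemma pairing_realw (R : realType) (w l : seq int) :
  pairing (realw R w) l = (dot w l)%:~R.
Proof. by rewrite dot_sum; apply: eq_bigr => i _; rewrite mulrC. Qed.

Lemma pairing_opp (R : realType) (w : 'I_8 -> R) (l : seq int) :
  pairing w (opp_vec l) = - pairing w l.
Proof.
by rewrite /pairing -sumrN; apply: eq_bigr => i _; rewrite nth_opp rmorphN mulNr.
Qed.

Lemma circuit_slack (R : realType) (w : 'I_8 -> R) (l : seq int)
    (u : 'rV[R]_4) (m : R) : l \in signed_circuits ->
  \sum_(i < 8) (l`_i)%:~R * (dotv u (pt R i) + w i - m) = pairing w l.
Proof.
move=> lc; under eq_bigr => i _ do rewrite mulrBr mulrDr.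
rewrite sumrB big_split /= -mulr_suml circuit_sum // mul0r subr0.
rewrite -dotv_sumr circuit_pt // /dotv big1 ?add0r // => j _.
by rewrite mxE mulr0.
Qed.

(** The heights [dotv u (pt R i) + w i - m] are nonnegative and vanish on
    [s], so every term of their pairing with [l] is at most 0 as soon as [s]
    contains the positive support; the sum is [pairing w l]. *)
Lemma lower_face_circuit (R : realType) (w : 'I_8 -> R) (s : {set 'I_8})
    (l : seq int) : l \in signed_circuits -> lower_face w s ->
    0 <= pairing w l -> (forall i : 'I_8, 0 < l`_i -> i \in s) ->
  pairing w l = 0 /\ (forall i : 'I_8, l`_i != 0 -> i \in s).
Proof.
move=> lc [u [m um]] wl ls.
pose F (i : 'I_8) := (l`_i)%:~R * (dotv u (pt R i) + w i - m).
have F0 i : F i <= 0.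
  rewrite /F; case: (um i) => le_m eq_m; have [l0|l0] := ltP 0 l`_i.
    by move: eq_m; rewrite ls // => /eqP <-; rewrite subrr mulr0.
  by apply: mulr_le0_ge0; rewrite ?lerz0 ?subr_ge0.
have sF : \sum_i F i = pairing w l by rewrite circuit_slack.
have wl0 : pairing w l = 0.
  by apply/eqP; rewrite eq_le wl andbT -sF sumr_le0.
split=> // i li; have/eqP : \sum_i - F i = 0 by rewrite sumrN sF wl0 oppr0.
rewrite psumr_eq0 => [/allP/(_ i)|j _]; last by rewrite oppr_ge0.
rewrite mem_index_enum oppr_eq0 mulf_eq0 intr_eq0 (negbTE li) /= subr_eq0.
by move=> /(_ isT); case: (um i) => _ <-; rewrite eq_sym.
Qed.

(** Since the points lie on a plane that misses the origin, affine
    independence is linear independence, witnessed here by a dual basis. *)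
Definition has_dual (R : realType) (s : {set 'I_8}) : Prop :=
  forall i, i \in s -> exists u : 'rV[R]_4,
    forall j, j \in s -> dotv u (pt R j) = (i == j)%:R.

Lemma has_dual_indep (R : realType) (s t : {set 'I_8}) :
  has_dual R s -> t \subset s -> aff_indep R t.
Proof.
move=> ds /fintype.subsetP ts c _ cp i it; have [u ui] := ds i (ts i it).
have := dotv_sumr (mem t) u c (pt R); rewrite cp.
rewrite (_ : dotv u 0 = 0); last by rewrite /dotv big1 // => j _; rewrite mxE mulr0.
rewrite (bigD1 i) //= ui ?ts // eqxx mulr1 big1 ?addr0 // => j /andP[jt ji].
by rewrite ui ?ts // eq_sym (negbTE ji) mulr0.
Qed.

Lemma has_dual_interp (R : realType) (s : {set 'I_8}) (y : 'I_8 -> R) :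
  has_dual R s ->
  exists u : 'rV[R]_4, forall i, i \in s -> dotv u (pt R i) = y i.
Proof.
move=> ds; have /boolp.choice[f Hf] (i : 'I_8) : exists u : 'rV[R]_4,
    forall j, i \in s -> j \in s -> dotv u (pt R j) = (i == j)%:R.
  case: (boolP (i \in s)) => [/ds[u ui]|_]; last by exists 0.
  by exists u => j _; apply: ui.
exists (\sum_(i in s) y i *: f i) => j js; rewrite dotv_suml (bigD1 j) //=.
rewrite Hf // eqxx mulr1 big1 ?addr0 // => i /andP[si ij].
by rewrite Hf // (negbTE ij) mulr0.
Qed.

Lemma mem_support (m : bitseq) (i : 'I_8) : (i : nat) \in support m = nth false m i.
Proof. by rewrite mem_filter mem_iota leq0n ltn_ord !andbT. Qed.

Lemma dot4_pt (R : realType) (a : seq int) (i : 'I_8) :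
  dotv (\row_j (a`_j)%:~R) (pt R i) = (dot4 a i)%:~R.
Proof.
rewrite /dotv !big_ord_recl big_ord0 !mxE /expo /= /dot4 /=.
by rewrite !rmorphD !rmorphM.
Qed.

Lemma basis_dual (R : realType) (s : {set 'I_8}) :
  mask_of s \in bases -> has_dual R s.
Proof.
rewrite mem_filter => /andP[/andP[_ /allP H] _] i si.
have {H} := H i; rewrite mem_support nth_mask_of => /(_ si)/allP H.
set a := dualvec _ _ in H.
pose v : 'rV[R]_4 := \row_j (a`_j)%:~R.
have va j : dotv v (pt R j) = (dot4 a j)%:~R by exact: dot4_pt.
have ai : dot4 a i != 0.
  by have := H i; rewrite mem_support nth_mask_of eqxx => /(_ si)/eqP.
exists ((dot4 a i)%:~R^-1 *: v) => j sj.
have -> : dotv ((dot4 a i)%:~R^-1 *: v) (pt R j) =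
    (dot4 a i)%:~R^-1 * dotv v (pt R j).
  by rewrite /dotv mulr_sumr; apply: eq_bigr => k _; rewrite mxE mulrA.
rewrite va; have := H j; rewrite mem_support nth_mask_of => /(_ sj)/eqP.
rewrite -val_eqE /=; have [->|_] := eqVneq (i : nat) j.
  by move=> ja; rewrite mulVf // intr_eq0 ja.
by move/negPn/eqP ->; rewrite mulr0.
Qed.

(** Reduces questions about faces to bases, which carry dual functionals. *)
Lemma pure_basis (M : seq bitseq) (t : {set 'I_8}) :
    pure bases M -> t \in complex M ->
  exists s : {set 'I_8}, [/\ mask_of s \in bases, s \in complex M & t \subset s].
Proof.
move=> /allP pM; rewrite finset.in_set => ft; have := pM _ (mask_of_mask t).
rewrite ft has_lazyE => /hasP[b]; rewrite mem_filter => /andP[fb bb] tb.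
have bm : b \in masks by move: bb; rewrite mem_filter => /andP[].
by exists (set_of b); split; rewrite -?submask_of ?mask_ofK // finset.in_set mask_ofK.
Qed.

Lemma nonfacesP (w : seq int) (n : bitseq) :
  reflect (exists l, [/\ l \in signed_circuits, 0 < dot w l & n = pos_support l])
    (n \in nonfaces w).
Proof.
rewrite /nonfaces; apply: (iffP (mapP)) => [[l]|[l [lc wl ->]]].
  by rewrite mem_filter => /andP[wl lc ->]; exists l.
by exists l; rewrite // mem_filter wl.
Qed.

Lemma mem_complex (w : seq int) (s : {set 'I_8}) :
  reflect (forall l, l \in signed_circuits -> 0 < dot w l ->
             exists2 i : 'I_8, 0 < l`_i & i \notin s)
    (s \in complex (nonfaces w)).
Proof.
rewrite finset.in_set; apply: (iffP (faceP _ _)) => H.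
  move=> l lc wl; have [sl _ _ _ _] := circuitsP lc.
  have ns := H (pos_support l) (introT (nonfacesP _ _) (ex_intro _ l (And3 lc wl erefl))).
  case: (boolP [exists i : 'I_8, (0 < l`_i) && (i \notin s)]).
    by case/existsP => i /andP[]; exists i.
  move/existsPn => ni; case/negP: ns; apply/pos_support_subP => // i li.
  by have := ni i; rewrite li /= negbK.
move=> n /nonfacesP[l [lc wl ->]]; have [sl _ _ _ _] := circuitsP lc.
by have [i li si] := H l lc wl; apply: contra si => /pos_support_subP; apply.
Qed.

(** * Weights and the faces they leave *)

(** Over a basis [s] containing [t] prescribe height 0 on [t] and a small
    height on the rest of [s].  The height of a further point is read off
    from its fundamental circuit, whose pairing with [w] must be positive:
    otherwise the opposite circuit would exclude [s] from the complex. *)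
Lemma complex_lower (R : realType) (w : seq int) (t : {set 'I_8}) :
  admissible bases w -> t \in complex (nonfaces w) -> lower_face (realw R w) t.
Proof.
move=> /andP[/allP gw pw] tw; have [s [bs sw ts]] := pure_basis pw tw.
(* At most eight terms bounded by 3 e have to sum to less than 1, the least
   positive value of an integral pairing. *)
have [e e0 e8] : exists2 e : R, 0 < e & (3 * e) *+ 8 < 1.
  by clear; exists (1 / 25); lra.
have [u us] := has_dual_interp
  (fun i => (if i \in t then 0 else e) - realw R w i) (basis_dual R bs).
pose F (i : 'I_8) := dotv u (pt R i) + realw R w i.
have Fs i : i \in s -> F i = if i \in t then 0 else e.
  by move=> si; rewrite /F us // subrK.
exists u, 0 => j; apply/leifP; rewrite -/(F j).
have [js|js] := boolP (j \in s).
  by rewrite Fs //; case: (j \in t).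
rewrite (_ : (j \in t) = false); last first.
  by apply/negbTE; apply: contra js => jt; apply: (fintype.subsetP ts j jt).
have /allP/(_ _ bs)/allP/(_ j) fj := fundamental_checked.
move: fj; rewrite mem_iota leq0n ltn_ord nth_mask_of (negbTE js).
move=> /(_ isT)/hasP[l lc /andP[lj /allP lsupp]].
have {}lsupp (i : 'I_8) : l`_i != 0 -> i != j -> i \in s.
  move=> li ij; have := lsupp i; rewrite mem_iota leq0n ltn_ord => /(_ isT).
  by rewrite li nth_mask_of orbC -[_ == _]/(i == j) (negbTE ij).
have [sl _ _ _ l3] := circuitsP lc.
(* The negative support of l lies in s, so it is a face. *)
have nl : ~~ face (nonfaces w) (pos_support (opp_vec l)) -> False.
  move/negP; apply; apply: face_sub (_ : face _ (mask_of s)).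
    apply/pos_support_subP => [|i]; first by rewrite size_map.
    rewrite nth_opp oppr_gt0 => li; apply: lsupp; first by rewrite lt_eqF.
    by apply: contraTneq li => ->; rewrite -leNgt ltW.
  by move: sw; rewrite finset.in_set.
have wl : 0 < dot w l.
  rewrite lt_neqAle eq_sym; apply/andP; split.
    apply/eqP => wl; apply: nl.
    have /implyP := gw (opp_vec l) (signed_opp lc); apply.
    by rewrite dot_opp wl oppr0.
  rewrite leNgt; apply/negP => wl; apply: nl; apply/negP => /faceP.
  move/(_ (pos_support (opp_vec l))) => H.
  have wl' : 0 < dot w (opp_vec l) by rewrite dot_opp oppr_gt0.
  have nw : pos_support (opp_vec l) \in nonfaces w.
    by apply/nonfacesP; exists (opp_vec l); split=> //; apply: signed_opp.
  by move/negP: (H nw); apply; apply/submaskP.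
have := circuit_slack (realw R w) u 0 lc.
rewrite pairing_realw (bigD1 j) //= subr0 -/(F j) => Fl.
have small : \sum_(i < 8 | i != j) (l`_i)%:~R * (dotv u (pt R i) + realw R w i - 0)
    <= \sum_(i < 8 | i != j) 3 * e.
  apply: ler_sum => i ij; rewrite subr0 -/(F i).
  have [->|li] := eqVneq l`_i 0; first by rewrite mul0r mulr_ge0 // ltW.
  rewrite Fs ?lsupp //; have := l3 i; rewrite ler_norml => /andP[_ li3].
  apply: (@le_trans _ _ (3 * (if i \in t then 0 else e))).
    apply: ler_wpM2r; first by case: ifP => // _; apply: ltW.
    by rewrite (_ : 3 = 3%:~R) // ler_int.
  by rewrite ler_wpM2l //; case: ifP => // _; apply: ltW.
have wl1 : 1 <= (dot w l)%:~R :> R by rewrite -[1]/(1%:~R) ler_int -gtz0_ge1.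
have : 0 < (l`_j)%:~R * F j.
  have lt1 : \sum_(i < 8 | i != j) 3 * e < 1.
    apply: (@le_lt_trans _ _ (\sum_(i < 8) 3 * e)).
      by rewrite [leRHS](bigD1 j) //= lerDr mulr_ge0 // ltW.
    by rewrite sumr_const card_ord.
  rewrite -(ltrD2r (\sum_(i < 8 | i != j) (l`_i)%:~R *
      (dotv u (pt R i) + realw R w i - 0))) add0r Fl.
  exact: le_lt_trans small (lt_le_trans lt1 wl1).
by rewrite pmulr_rgt0 // ltr0z.
Qed.

Lemma hullP (R : realType) (s : {set 'I_8}) (x : 'rV[R]_4) :
  hull R s x <-> exists c : 'I_8 -> R,
    [/\ forall i, 0 <= c i, forall i, i \notin s -> c i = 0,
        \sum_i c i = 1 & x = \sum_i c i *: pt R i].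
Proof.
split=> [[c [c0 c1 ->]]|[c [c0 cs c1 ->]]].
  exists (fun i => if i \in s then c i else 0); split.
  - by move=> i; case: ifP.
  - by move=> i /negbTE ->.
  - by rewrite -big_mkcond.
  - rewrite big_mkcond; apply: eq_bigr => i _; case: ifP => // _.
    by rewrite scale0r.
exists c; split=> //.
  by rewrite -c1 [RHS](bigID (mem s)) /= [X in _ + X]big1 ?addr0.
rewrite [LHS](bigID (mem s)) /= [X in _ + X]big1 ?addr0 // => i /cs ->.
by rewrite scale0r.
Qed.

Lemma hullS (R : realType) (s t : {set 'I_8}) (x : 'rV[R]_4) :
  s \subset t -> hull R s x -> hull R t x.
Proof.
move=> /fintype.subsetP st /hullP[c [c0 cs c1 cx]]; apply/hullP; exists c.
by split=> // i it; apply: cs; apply: contra it; apply: st.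
Qed.

(** A point of both hulls has two representations of the same, minimal,
    weight; minimality with respect to the functional of [s] forces the one
    supported on [t] to be supported on [s] too. *)
Lemma lower_hullI (R : realType) (w : 'I_8 -> R) (s t : {set 'I_8}) :
    lower_face w s -> lower_face w t ->
  (hull R s `&` hull R t)%classic = hull R (s :&: t).
Proof.
move=> ls lt; apply/seteqP; split=> x; last first.
  by move=> xst; split; apply: hullS xst; rewrite (subsetIl, subsetIr).
move=> [/hullP[c [c0 cs c1 cx]] /hullP[d [d0 dt d1 dx]]].
have cost (a : 'I_8 -> R) u m : \sum_i a i = 1 -> x = \sum_i a i *: pt R i ->
    \sum_i a i * (dotv u (pt R i) + w i - m) =
    dotv u x + \sum_i a i * w i - m.
  move=> a1 ->; rewrite dotv_sumr -big_split -[m in RHS]mul1r -a1 mulr_suml.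
  by rewrite -sumrB; apply: eq_bigr => i _ /=; rewrite mulrBr mulrDr.
have le_cost (s' : {set 'I_8}) (a b : 'I_8 -> R) : lower_face w s' ->
    (forall i, i \notin s' -> a i = 0) -> (forall i, 0 <= b i) ->
    \sum_i a i = 1 -> x = \sum_i a i *: pt R i ->
    \sum_i b i = 1 -> x = \sum_i b i *: pt R i ->
    \sum_i a i * w i <= \sum_i b i * w i ?= iff
      [forall i, (i \notin s') ==> (b i == 0)].
  move=> [u [m um]] as' b0 a1 ax b1 bx.
  have := cost a u m a1 ax; rewrite big1 => [|i _]; last first.
    have [is'|/as' ->] := boolP (i \in s'); last by rewrite mul0r.
    by have [_] := um i; rewrite is' => /eqP <-; rewrite subrr mulr0.
  have bF i : 0 <= b i * (dotv u (pt R i) + w i - m).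
    by rewrite mulr_ge0 // subr_ge0; case: (um i).
  move/eqP; rewrite eq_sym subr_eq0 => /eqP am.
  have bm := cost b u m b1 bx.
  have eb : \sum_i b i * w i - \sum_i a i * w i =
      \sum_i b i * (dotv u (pt R i) + w i - m) by rewrite bm -am; ring.
  split; first by rewrite -subr_ge0 eb sumr_ge0.
  rewrite eq_sym -subr_eq0 eb psumr_eq0 //; apply/allP/forallP => H i.
    have := H i; rewrite mem_index_enum mulf_eq0 => /(_ isT).
    have [_] := um i; rewrite eq_sym -subr_eq0 => ->.
    by case: (i \in s'); rewrite ?orbF.
  move=> _; rewrite mulf_eq0; have [_] := um i.
  by rewrite eq_sym -subr_eq0 => ->; have := H i; case: (i \in s'); rewrite ?orbT ?orbF.
have [le1 _] := le_cost t d c lt dt c0 d1 dx c1 cx.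
have [le2 eq2] := le_cost s c d ls cs d0 c1 cx d1 dx.
move: eq2; rewrite eq_le le1 le2 => /esym/forallP ds.
apply/hullP; exists d; split=> // i; rewrite inE negb_and => /orP[is'|/dt //].
by have := ds i; rewrite is' => /eqP.
Qed.

(** * Covering by the faces that a weight leaves *)

Lemma coord_sum_continuous (R : realType) (f : 'I_8 -> R) :
  continuous (fun c : 'rV[R]_8 => \sum_i c 0 i * f i).
Proof.
apply: continuous_big => [|i _ c]; first exact: add_continuous.
have H := @coord_continuous R 1 8 0 i c.
exact: (cvgM H (cvg_cst _)).
Qed.

(** Makes the minimum in the next lemma exist. *)
Lemma representations_compact (R : realType) (x : 'rV[R]_4) :
  compact [set c : 'rV[R]_8 | [/\ forall i, 0 <= c 0 i, \sum_i c 0 i = 1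
                                & \sum_i c 0 i *: pt R i = x]]%classic.
Proof.
pose box := [set c : 'rV[R]_8 | forall i, `[0, 1]%classic (c ord0 i)]%classic.
have cbox : compact box.
  have := @rV_compact R 8 (fun=> `[0, 1]%classic).
  by apply => i; apply: segment_compact.
have csum (f : 'I_8 -> R) (y : R) :
    closed [set c : 'rV[R]_8 | \sum_i c 0 i * f i = y]%classic.
  apply: (@preimage_closed _ _ (fun c : 'rV[R]_8 => \sum_i c 0 i * f i)
    [set z | z = y]%classic).
    by move=> c _; apply: coord_sum_continuous.
  exact: closed_eq.
have {}csum : closed ([set c : 'rV[R]_8 | \sum_i c 0 i * 1 = 1] `&`
   \bigcap_(j in [set: 'I_4])
     [set c : 'rV[R]_8 | \sum_i c 0 i * pt R i 0 j = x 0 j])%classic.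
  by apply: closedI => //; apply: closed_bigI => j _.
have := compact_closedI cbox csum; congr compact; apply/seteqP; split=> c.
  move=> [c01 [c1 cx]]; split=> [i||].
  - by have := c01 i; rewrite /= in_itv /= => /andP[].
  - by rewrite -[RHS]c1; apply: eq_bigr => i _; rewrite mulr1.
  - apply/rowP => j; rewrite summxE -(cx j I); apply: eq_bigr => i _.
    by rewrite !mxE.
move=> [c0 c1 cx]; split=> [i|].
  rewrite /= in_itv /= c0 /= -c1 (bigD1 i) //= lerDl.
  by apply: sumr_ge0.
split=> [|j _] /=; first by rewrite -[RHS]c1; apply: eq_bigr => i _; rewrite mulr1.
by rewrite -cx summxE; apply: eq_bigr => i _; rewrite !mxE.
Qed.

(** A minimizer of the weight among the representations of [x] has a face as
    its support: otherwise a circuit [l] of positive pairing has its positive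
    support inside, and subtracting a small multiple of [l] keeps a
    representation while lowering its weight. *)
Lemma complex_cover (R : realType) (w : seq int) (x : 'rV[R]_4) :
  polytope R x -> exists2 s, s \in complex (nonfaces w) & hull R s x.
Proof.
move=> /hullP[c0 [c0_ge0 _ c0_1 c0_x]].
pose K := [set c : 'rV[R]_8 | [/\ forall i, 0 <= c 0 i, \sum_i c 0 i = 1
                                & \sum_i c 0 i *: pt R i = x]]%classic.
pose cost (c : 'rV[R]_8) : R := \sum_i c 0 i * realw R w i.
have ccost : {within K, continuous cost}%classic.
  apply: continuous_subspaceT => c; apply: coord_sum_continuous.
have K0 : (K !=set0)%classic.
  exists (\row_i c0 i); split=> [i||]; rewrite ?mxE //.
  - by rewrite -c0_1; apply: eq_bigr => i _; rewrite mxE.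
  - by rewrite c0_x; apply: eq_bigr => i _; rewrite mxE.
have [c /set_mem[c_ge0 c_1 c_x] cmin] :=
  compact_EVT_min K0 (@representations_compact R x) ccost.
exists [set i | 0 < c 0 i]; last first.
  apply/hullP; exists (c 0); split=> // i; rewrite inE -leNgt => ci.
  by apply/eqP; rewrite eq_le ci c_ge0.
apply/mem_complex => l lc wl.
case: (boolP [exists i : 'I_8, (0 < l`_i) && (i \notin [set i | 0 < c 0 i])]).
  by case/existsP => i /andP[]; exists i.
move=> /existsPn nl.
have {}nl (i : 'I_8) : 0 < l`_i -> 0 < c 0 i.
  by move=> li; have := nl i; rewrite li /= negbK inE.
have [_ _ _ _ l3] := circuitsP lc.
(* Entries of circuits are at most 3, so c - t l stays nonnegative. *)
pose t := \big[Num.min/1]_(i < 8 | 0 < l`_i) (c 0 i / 3).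
have t0 : 0 < t.
  rewrite /t; elim/big_ind: _ => // [x0 y0|i /nl ci]; last by rewrite divr_gt0.
  by rewrite lt_min => -> ->.
have tc i : 0 <= c 0 i - t * (l`_i)%:~R.
  have [li|li] := ltP 0 l`_i; last first.
    by rewrite subr_ge0 (le_trans _ (c_ge0 i)) // pmulr_rle0 // lerz0.
  have : t <= c 0 i / 3 by rewrite /t (bigD1 i) //= ge_min lexx.
  rewrite ler_pdivlMr // => tc; rewrite subr_ge0 (le_trans _ tc) //.
  rewrite ler_pM2l // (_ : 3 = 3%:~R) // ler_int.
  by have := l3 i; rewrite ler_norml => /andP[].
pose c' : 'rV[R]_8 := \row_i (c 0 i - t * (l`_i)%:~R).
have Kc' : K c'.
  split=> [i||]; first by rewrite mxE.
  - under eq_bigr => i _ do rewrite mxE.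
    by rewrite sumrB -mulr_sumr circuit_sum // mulr0 subr0.
  - under eq_bigr => i _ do rewrite mxE scalerBl -scalerA.
    by rewrite sumrB -scaler_sumr circuit_pt // scaler0 subr0.
have := cmin c'; rewrite inE => /(_ Kc').
rewrite /cost; under [leRHS]eq_bigr => i _ do rewrite mxE mulrBl -mulrA.
rewrite sumrB -mulr_sumr -/(pairing _ _) pairing_realw leNgt gtrBl.
by rewrite mulr_gt0 // ltr0z.
Qed.

Lemma complex_triangulation (R : realType) (w : seq int) :
  admissible bases w -> triangulation R (complex (nonfaces w)).
Proof.
move=> gw; have /andP[_ pw] := gw; split.
- move=> s t; rewrite !finset.in_set => sw ts.
  by apply: face_sub sw; rewrite submask_of.
- move=> s /(pure_basis pw)[b [bb _ sb]].
  exact: has_dual_indep (basis_dual R bb) sb.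
- move=> s t sw tw; apply: lower_hullI; apply: complex_lower gw _; eassumption.
- apply/seteqP; split=> [x [s _]|x /(complex_cover w)[s sw xs]].
    by apply: hullS; apply/fintype.subsetP => i; rewrite inE.
  by exists s.
Qed.

Lemma complex_lower_faces (R : realType) (w : seq int) :
  admissible bases w -> lower_faces (realw R w) = complex (nonfaces w).
Proof.
move=> gw; apply/setP => s; rewrite inE; apply/asboolP/idP; last exact: complex_lower.
move=> ls; apply/mem_complex => l lc wl.
case: (boolP [exists i : 'I_8, (0 < l`_i) && (i \notin s)]).
  by case/existsP => i /andP[]; exists i.
move=> /existsPn nl.
have {}nl (i : 'I_8) : 0 < l`_i -> i \in s.
  by move=> li; have := nl i; rewrite li /= negbK.
have [] := lower_face_circuit lc ls _ nl; rewrite pairing_realw ?ler0z ?ltW //.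
by move/eqP; rewrite intr_eq0 (gt_eqF wl).
Qed.

(** The barycenter of a face of [U] lies in the hull of a face of [T], which
    is also a face of [U]; affine independence then puts the former inside
    the latter. *)
Lemma triangulation_sub_eq (R : realType) (T U : {set {set 'I_8}}) :
  triangulation R T -> triangulation R U -> T \subset U -> T = U.
Proof.
move=> [Tsub _ _ Tcov] [_ Uind UI Ucov] /fintype.subsetP TU.
apply/setP => s; apply/idP/idP; first exact: TU.
have Tnonempty : finset.set0 \in T.
  have : polytope R (pt R ord0).
    apply/hullP; exists (fun i => (i == ord0)%:R); split=> //.
    - by move=> i; rewrite inE.
    - by rewrite (bigD1 ord0) //= big1 ?addr0 // => i /negbTE ->.
    - by rewrite (bigD1 ord0) //= scale1r big1 ?addr0 // => i /negbTE ->; rewrite scale0r.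
  rewrite -Tcov => -[t tT _]; apply: Tsub tT _; exact: finset.sub0set.
move=> sU; have [->//|s0] := eqVneq s finset.set0.
pose k : R := #|s|%:R; have k0 : 0 < k by rewrite ltr0n card_gt0.
pose x := \sum_(i in s) k^-1 *: pt R i.
have hs : hull R s x.
  exists (fun _ => k^-1); split=> // [_|]; first by rewrite invr_ge0 ltW.
  by rewrite sumr_const -mulr_natr mulVf // gt_eqF.
have : polytope R x by apply: hullS hs; apply/fintype.subsetP => i; rewrite inE.
rewrite -Tcov => -[t tT ht]; have := UI s t sU (TU t tT).
move=> /seteqP[/(_ x (conj hs ht)) /hullP[c [c0 cst c1 cx]] _].
have kc : \sum_(i in s) c i = 1.
  rewrite -c1 [RHS](bigID (mem s)) /= [X in _ + X]big1 ?addr0 // => i si.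
  by rewrite cst // inE (negbTE si).
have kx : \sum_(i in s) c i *: pt R i = x.
  rewrite cx [RHS](bigID (mem s)) /= [X in _ + X]big1 ?addr0 // => i si.
  by rewrite cst ?scale0r // inE (negbTE si).
have ck i : i \in s -> c i - k^-1 = 0.
  apply: (Uind s sU (fun i => c i - k^-1)).
    by rewrite sumrB kc sumr_const -mulr_natr mulVf ?subrr // gt_eqF.
  by under eq_bigr => j _ do rewrite scalerBl; rewrite sumrB kx subrr.
apply: Tsub tT _; apply/fintype.subsetP => i si; apply: contraT => it.
have := ck i si; rewrite cst ?inE ?si //= sub0r => /eqP.
by rewrite oppr_eq0 invr_eq0 gt_eqF.
Qed.

(** * Completeness of the list of weights *)

(** A weight that pairs nontrivially with every circuit; it decides zero
    pairings, as an infinitesimal perturbation would. *)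
Definition tiebreak : seq int := int_weights [:: 5; 2; 8; 4; 2; 9; 5; 9]%N.

Definition lexpos (R : realType) (w : 'I_8 -> R) (l : seq int) : bool :=
  (0 < pairing w l) || (pairing w l == 0) && (0 < dot tiebreak l).

Lemma tiebreak_generic : all (fun l => dot tiebreak l != 0) circuits.
Proof. by vm_compute. Qed.

Lemma lexpos_opp (R : realType) (w : 'I_8 -> R) (l : seq int) :
  l \in circuits -> lexpos w l || lexpos w (opp_vec l).
Proof.
move=> /(allP tiebreak_generic) tl.
rewrite /lexpos pairing_opp dot_opp !oppr_gt0 oppr_eq0.
by case: (ltrgt0P (pairing w l)) => //= _; rewrite lt_def orbC -lt_def; move: tl; case: ltrgt0P.
Qed.

(** Lexicographic positivity is preserved by positive combinations and fails
    for 0. *)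
Lemma dependent3_lexpos (R : realType) (w : 'I_8 -> R) (x y z : seq int) :
  dependent3 x y z -> lexpos w x -> lexpos w y -> ~~ lexpos w z.
Proof.
rewrite /dependent3 has_lazyE => /hasP[p p3]; rewrite has_lazyE => /hasP[q q3].
rewrite has_lazyE => /hasP[r r3]; rewrite has_lazyE -all_predC => /allP dep.
have pos_coef a : a \in [:: 1; 2; 3] -> 0 < a :> int.
  by rewrite !inE => /or3P[] /eqP ->.
have [p0 q0 r0] : [/\ 0 < p, 0 < q & 0 < r] by split; apply: pos_coef.
have dep0 (A : numDomainType) (f : 'I_8 -> A) : \sum_(i < 8)
    (p%:~R * (x`_i)%:~R + q%:~R * (y`_i)%:~R + r%:~R * (z`_i)%:~R) * f i = 0.
  rewrite big1 // => i _; have := dep i; rewrite mem_iota leq0n ltn_ord.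
  move=> /(_ isT); rewrite /= negbK => /eqP pqr.
  by rewrite -!rmorphM -!rmorphD /= pqr mul0r.
have dw : p%:~R * pairing w x + q%:~R * pairing w y + r%:~R * pairing w z = 0.
  rewrite -(dep0 _ w) /pairing !mulr_sumr -!big_split; apply: eq_bigr => i _ /=.
  by rewrite !mulrDl !mulrA.
have dt : p * dot tiebreak x + q * dot tiebreak y + r * dot tiebreak z = 0.
  rewrite -[RHS](dep0 int (fun i => tiebreak`_i)).
  rewrite -[dot _ x]intz -[dot _ y]intz -[dot _ z]intz !dot_sum !mulr_sumr.
  rewrite -!big_split; apply: eq_bigr => i _ /=; rewrite !intz; ring.
have pR : 0 < p%:~R :> R by rewrite ltr0z.
have qR : 0 < q%:~R :> R by rewrite ltr0z.
have rR : 0 < r%:~R :> R by rewrite ltr0z.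
rewrite /lexpos; move: dw dt pR qR rR p0 q0 r0; clear.
move: (pairing w x) (pairing w y) (pairing w z) (p%:~R : R) (q%:~R : R) (r%:~R : R).
move=> X Y Z P Q S; move: (dot _ x) (dot _ y) (dot _ z) => x' y' z'.
move=> dw dt P0 Q0 S0 p0 q0 r0 /orP Hx /orP Hy; apply/negP => /orP Hz.
have X0 : 0 <= X by case: Hx => [/ltW|/andP[/eqP->]].
have Y0 : 0 <= Y by case: Hy => [/ltW|/andP[/eqP->]].
have Z0 : 0 <= Z by case: Hz => [/ltW|/andP[/eqP->]].
have PX : P * X = 0 by nra.
have QY : Q * Y = 0 by nra.
have SZ : S * Z = 0 by nra.
have x0 : 0 < x'.
  case: Hx => [|/andP[]] // X1; have := mulr_gt0 P0 X1; by rewrite PX ltxx.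
have y0 : 0 < y'.
  case: Hy => [|/andP[]] // X1; have := mulr_gt0 Q0 X1; by rewrite QY ltxx.
have z0 : 0 < z'.
  case: Hz => [|/andP[]] // X1; have := mulr_gt0 S0 X1; by rewrite SZ ltxx.
have := addr_gt0 (addr_gt0 (mulr_gt0 p0 x0) (mulr_gt0 q0 y0)) (mulr_gt0 r0 z0).
by rewrite dt ltxx.
Qed.

Lemma explore_sound (D : seq (seq (nat * bool * (nat * bool) * bool)))
    (L : seq (seq bitseq)) (b : nat -> bool) :
    (forall k, (k < 26)%N -> ~~ conflict D (mkseq b k.+1)) ->
  explore D L 26 [::] -> closed_leaf L (mkseq b 26).
Proof.
move=> Db; suff H n k : (k + n = 26)%N -> explore D L n (mkseq b k) ->
  closed_leaf L (mkseq b 26) by apply: (H 26 0%N).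
elim: n k => [|n IH] k /=; first by rewrite addn0 => ->.
move=> kn /andP[Ht Hf]; apply: (IH k.+1); first by rewrite addSnnS.
have kb : ~~ conflict D (mkseq b k.+1) by apply: Db; rewrite -kn addnS ltnS leq_addr.
have e : mkseq b k.+1 = rcons (mkseq b k) (b k).
  by rewrite /mkseq -addn1 iotaD map_cat cats1.
move: kb Ht Hf; rewrite e; case: (b k) => /negbTE -> //.
Qed.

Lemma explore_checked : explore dependences (map nonfaces all_weights) 26 [::].
Proof. by vm_compute. Qed.

Lemma size_circuits : size circuits = 26%N. Proof. by vm_compute. Qed.

Lemma orient_signed (k : nat) (b : bool) :
  (k < 26)%N -> orient k b \in signed_circuits.
Proof.
move=> k26; have kc : nth [::] circuits k \in circuits.
  by apply: mem_nth; rewrite size_circuits.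
by rewrite /orient mem_cat; case: b; rewrite ?kc // map_f ?orbT.
Qed.

(** Lexicographic positivity only gives a nonnegative pairing, but this is
    enough: if a face of a triangulation contained the positive support of
    such a circuit, [lower_face_circuit] would make it contain the whole
    circuit, against affine independence. *)
Lemma regular_from_list (R : realType) (w : 'I_8 -> R) :
    triangulation R (lower_faces w) ->
  exists2 v, v \in all_weights & lower_faces w = complex (nonfaces v).
Proof.
move=> triT; pose b k := lexpos w (nth [::] circuits k).
have posb k : (k < 26)%N -> lexpos w (orient k (b k)).
  move=> k26; have /(lexpos_opp w) : nth [::] circuits k \in circuits.
    by apply: mem_nth; rewrite size_circuits.
  by rewrite /orient /b; case: ifP => //= _ ->.
(* The orientations b satisfy all the relations that the search consults. *)
have noconf k : (k < 26)%N -> ~~ conflict dependences (mkseq b k.+1).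
  move=> k26; rewrite /conflict size_mkseq /=; apply/hasPn.
  rewrite /dependences (nth_map 0%N) ?size_iota // nth_iota // add0n => -[[ib jc] d].
  rewrite mem_filter => /andP[dep /allpairsPdep[p [d' [pin _ [ep ed]]]]].
  move: pin; rewrite -ep => /allpairsPdep[ib' [jc' [iin jin [ei ej]]]].
  have i26 : (ib.1 < k)%N.
    rewrite ei; case/allpairsPdep: iin => i [c [ii _ ->]] /=.
    by move: ii; rewrite mem_iota add0n.
  have j26 : (jc.1 < k)%N.
    rewrite ej; case/allpairsPdep: jin => j [c [jj _ ->]] /=.
    by move: jj; rewrite mem_iota -ei subnKC // => /andP[].
  rewrite (nth_mkseq _ _ (ltn_trans i26 (ltnSn k))).
  rewrite (nth_mkseq _ _ (ltn_trans j26 (ltnSn k))) (nth_mkseq _ _ (ltnSn k)).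
  apply/negP => /and3P[/eqP eib /eqP ejc /eqP ed'].
  have := posb k k26; rewrite ed'; apply/negP; apply: dependent3_lexpos dep _ _.
    rewrite /= -eib; exact: posb (ltn_trans i26 k26).
  rewrite /= -ejc; exact: posb (ltn_trans j26 k26).
have := @explore_sound dependences (map nonfaces all_weights) b noconf explore_checked.
rewrite /closed_leaf has_lazyE => /hasP[_ /mapP[v vW ->] vN]; exists v => //.
have gv := allP weights_checked v vW.
apply: (triangulation_sub_eq triT (complex_triangulation R gv)).
apply/fintype.subsetP => s sT; rewrite finset.in_set; apply/faceP => m mv.
apply/negP => ms; move: vN; rewrite has_lazyE => /hasPn/(_ m mv).
move=> /negP; apply; apply/faceP => n /mapP[k]; rewrite mem_iota add0n => k26.
rewrite nth_mkseq // => -> ; apply/negP => km; have ks := submask_trans km ms.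
have lc := orient_signed (b k) k26.
have [sl _ _ [i li] _] := circuitsP lc.
have ls : lower_face w s by move: sT; rewrite inE => /asboolP.
have wl : 0 <= pairing w (orient k (b k)).
  by have := posb k k26; rewrite /lexpos => /orP[/ltW|/andP[/eqP ->]].
have [_ ls'] := lower_face_circuit lc ls wl (elimT (pos_support_subP _ sl) ks).
have [_ Tind _ _] := triT.
have := Tind s sT (fun i => ((orient k (b k))`_i)%:~R).
have ext (V : nmodType) (F : 'I_8 -> V) :
    (forall i : 'I_8, (orient k (b k))`_i = 0 -> F i = 0) ->
    \sum_(i in s) F i = \sum_i F i.
  move=> F0; rewrite [RHS](bigID (mem s)) /= [X in _ + X]big1 ?addr0 // => j js.
  by apply: F0; apply: contraNeq js; apply: ls'.
rewrite !ext ?circuit_sum ?circuit_pt // => [|j ->|j ->//]; last by rewrite scale0r.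
by move=> /(_ erefl erefl i (ls' i li)) /eqP; rewrite intr_eq0 (negbTE li).
Qed.

(** * Symmetries of a complex *)

Definition face_code (T : {set {set 'I_8}}) : bitseq :=
  [seq set_of m \in T | m <- masks].

Lemma face_code_inj : injective face_code.
Proof.
move=> T U eTU; apply/setP => s; rewrite -(set_ofK s).
have /eq_in_map := eTU; apply; exact: mask_of_mask.
Qed.

Lemma face_code_complex (M : seq bitseq) : face_code (complex M) = code M.
Proof. by apply/eq_in_map => m mm; rewrite finset.in_set mask_ofK. Qed.

Lemma card_set_seq (T : finType) (s : seq T) : #|[set x in s]| = size (undup s).
Proof.
rewrite cardsE -(card_uniqP (undup_uniq s)); apply: eq_card => x.
by rewrite mem_undup.
Qed.

Lemma size_undup_eq_mem (T : eqType) (s t : seq T) :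
  s =i t -> size (undup s) = size (undup t).
Proof.
move=> st; apply/perm_size/uniq_perm; rewrite ?undup_uniq // => x.
by rewrite !mem_undup.
Qed.

(** Turns a cardinality into a computation on codes. *)
Lemma card_set_codes (s : seq {set {set 'I_8}}) :
  #|[set x in s]| = size (undup (map face_code s)).
Proof.
by rewrite card_set_seq (undup_map_inj face_code_inj) size_map.
Qed.

Definition perm_list (p : {perm 'I_8}) : seq nat := mkseq (fun k => p (inord k) : nat) 8.

(** Acting on a complex permutes masks, so orbits can be evaluated. *)
Lemma face_code_act (M : seq bitseq) (p : {perm 'I_8}) :
  face_code (('P^*^*)%act (complex M) p) = act_code (perm_list p) M.
Proof.
apply/eq_in_map => m mm.
have -> : (set_of m \in ('P^*^*)%act (complex M) p) =
    ((p @^-1: set_of m)%SET \in complex M).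
  rewrite /= /setact; apply/imsetP/idP => [[s sM] ->|pm].
    suff -> : (p @^-1: [set aperm x p | x in s])%SET = s by [].
    apply/setP => i; rewrite inE; apply/imsetP/idP => [[j js]|is'].
      by rewrite /= /aperm => /perm_inj ->.
    by exists i.
  exists (p @^-1: set_of m)%SET => //; apply/setP => i; apply/idP/imsetP => [im|].
    exists (p^-1 i)%g; last by rewrite /= /aperm permKV.
    by move: im; rewrite !inE permKV.
  by case=> j; rewrite inE => jm ->.
rewrite finset.in_set; congr face; apply: (@eq_from_nth _ false) => [|k].
  by rewrite /permute size_map !size_mkseq.
rewrite size_mkseq => k8; rewrite /permute (nth_map 0%N) ?size_mkseq //.
by rewrite /perm_list /mask_of !nth_mkseq // !inE.
Qed.

Lemma expoK (i : 'I_8) (e : seq nat) : size e = 4%N ->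
  (forall j : 'I_4, expo i j = nth 0%N e j) -> index e exponents = i.
Proof.
move=> se ie; suff -> : e = nth [::] exponents i.
  by apply: index_uniq; [exact: ltn_ord|].
apply: (@eq_from_nth _ 0%N) => [|k]; rewrite se.
  have /allP/(_ (nth [::] exponents i)) :
    all (fun e => size e == 4%N) exponents by [].
  by rewrite mem_nth => [/(_ isT)/eqP|]; last exact: ltn_ord.
by move=> k4; rewrite -(ie (Ordinal k4)).
Qed.

Definition perm_expo (s : seq nat) (e : seq nat) : seq nat :=
  [seq nth 0%N e (nth 0%N s j) | j <- iota 0 4].

Lemma perm_list_sym (p : {perm 'I_8}) : p \in sym_group -> perm_list p \in sym_list.
Proof.
rewrite inE => /existsP[s /forallP sp].
have p8 : all (fun i => (i < 8)%N) (perm_list p).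
  by apply/allP => _ /mapP[k _ ->]; apply: ltn_ord.
have ep : perm_list p = [seq index (perm_expo (mkseq (fun k => s (inord k) : nat) 4) e)
    exponents | e <- exponents].
  apply: (@eq_from_nth _ 0%N) => [|k]; first by rewrite size_mkseq.
  rewrite size_mkseq => k8; rewrite nth_mkseq // (nth_map [::]) //.
  apply/esym/expoK => [|j]; first by rewrite size_map size_iota.
  have /forallP/(_ j)/eqP := sp (inord k); rewrite /expo inordK // => ->.
  rewrite (nth_map 0%N) ?size_iota // nth_iota // add0n.
  by rewrite nth_mkseq // inord_val.
rewrite mem_filter p8 ep.
apply: (map_f (fun s => [seq index (perm_expo s e) exponents | e <- exponents])).
rewrite mem_permutations uniq_perm ?iota_uniq //.
  rewrite map_inj_in_uniq ?iota_uniq // => j k.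
  rewrite !mem_iota /= add0n => j4 k4 /val_inj /perm_inj /(congr1 val).
  by rewrite /= !inordK.
move=> j; rewrite mem_iota /= add0n; apply/mapP/idP => [[k _ ->]|j4].
  exact: ltn_ord.
exists ((s^-1)%g (Ordinal j4) : nat); first by rewrite mem_iota /= ltn_ord.
by rewrite inord_val permKV.
Qed.

Lemma sym_list_uniq : all uniq sym_list. Proof. by vm_compute. Qed.

Lemma sym_list_perm_list (q : seq nat) : q \in sym_list ->
  exists2 p : {perm 'I_8}, p \in sym_group & perm_list p = q.
Proof.
move=> qs; have uq := allP sym_list_uniq q qs.
move: qs; rewrite mem_filter => /andP[/allP q8 /mapP[s]].
rewrite mem_permutations => ps eq.
have sq : size q = 8%N by rewrite eq size_map.
have ss : size s = 4%N by rewrite (perm_size ps).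
have s4 j : (j < 4)%N -> (nth 0%N s j < 4)%N.
  move=> j4; have : nth 0%N s j \in s by rewrite mem_nth ?ss.
  by rewrite (perm_mem ps) mem_iota.
have us : uniq s by rewrite (perm_uniq ps) iota_uniq.
pose f (j : 'I_4) : 'I_4 := inord (nth 0%N s j).
have fi : injective f.
  move=> j k /(congr1 val); rewrite /= !inordK ?s4 // => /eqP.
  by rewrite nth_uniq ?ss // => /eqP /val_inj.
have q8' (i : 'I_8) : (nth 0%N q i < 8)%N by rewrite q8 // mem_nth ?sq.
pose g (i : 'I_8) : 'I_8 := inord (nth 0%N q i).
have gi : injective g.
  move=> j k /(congr1 val); rewrite /= !inordK // => /eqP.
  by rewrite nth_uniq ?sq // => /eqP /val_inj.
exists (perm gi); last first.
  apply: (@eq_from_nth _ 0%N) => [|k]; first by rewrite size_mkseq sq.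
  rewrite size_mkseq => k8; rewrite nth_mkseq // permE /g.
  by rewrite (inordK (q8' (inord k))) (inordK k8).
rewrite inE; apply/existsP; exists (perm fi); apply/forallP => i.
apply/forallP => j; rewrite !permE /expo /= inordK // [in X in X == _]eq.
rewrite (nth_map [::]) // nth_index; last first.
  rewrite -index_mem; have := q8' i; rewrite eq (nth_map [::]) //.
by rewrite (nth_map 0%N) ?size_iota // nth_iota // add0n inordK ?s4.
Qed.

Lemma sym_orbit_codes (M : seq bitseq) (U : {set {set 'I_8}}) :
  (U \in sym_orbit (complex M)) = (face_code U \in orbit_codes M).
Proof.
apply/orbitP/mapP => [[p pG <-]|[q qs cU]].
  by exists (perm_list p); [exact: perm_list_sym|exact: face_code_act].
have [p pG pq] := sym_list_perm_list qs; exists p => //.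
by apply: face_code_inj; rewrite face_code_act cU pq.
Qed.

Lemma card_sym_orbit (M : seq bitseq) :
  #|sym_orbit (complex M)| = size (undup (orbit_codes M)).
Proof.
have -> : sym_orbit (complex M) =
    [set x in [seq ('P^*^*)%act (complex M) p | p <- enum sym_group]].
  apply/setP => U; rewrite inE; apply/orbitP/mapP => -[p pG pU].
    by exists p; rewrite ?mem_enum.
  by move: pG; rewrite mem_enum => pG; exists p.
rewrite card_set_codes -map_comp; apply: size_undup_eq_mem => c.
apply/mapP/mapP => [[p pG ->]|[q qs ->]].
  exists (perm_list p); first by apply: perm_list_sym; rewrite -mem_enum.
  exact: face_code_act.
have [p pG <-] := sym_list_perm_list qs; exists p; first by rewrite mem_enum.
by rewrite /= face_code_act.
Qed.

(** * Lebesgue measure under affine maps *)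

Section Volumes.
Local Open Scope classical_set_scope.

(** By uniqueness of Lebesgue measure it is enough to compare half-open
    intervals; the sign of [a] decides which ends of the preimage are closed. *)
Lemma lebesgue_affine (R : realType) (a b : R) (A : set R) : a != 0 ->
    measurable A ->
  lebesgue_measure ((fun x => a * x + b) @^-1` A) =
  (`|a|^-1%:E * lebesgue_measure A)%E.
Proof.
move=> a0 mA; pose f : measurableTypeR R -> measurableTypeR R := fun x => a * x + b.
have mf : measurable_fun setT f.
  by apply: measurable_funD => //; apply: measurable_funM.
have na0 : 0 < `|a| by rewrite normr_gt0.
suff -> : lebesgue_measure A = (`|a|%:E * lebesgue_measure (f @^-1` A))%E.
  by rewrite muleA -EFinM mulVf ?mul1e // gt_eqF.
have := @lebesgue_measure_unique R
  (mscale (NngNum (normr_ge0 a)) (pushforward lebesgue_measure f)).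
move=> /(_ mf); apply => // _ [[c d]] _ <-.
pose S := [set x : R | (c < f x <= d)%R].
have eS : f @^-1` `]c, d] = S.
  by apply/seteqP; split=> x /=; rewrite in_itv.
suff E : lebesgue_measure `]c, d] = (`|a|%:E * lebesgue_measure S)%E.
  by rewrite [LHS]E /mscale /pushforward /= -eS.
rewrite {eS}/S.
have [a_gt0|a_lt0|a_eq0] := ltgtP a 0; last by rewrite a_eq0 eqxx in a0.
- have -> : [set x : R | (c < f x <= d)%R] = `[(d - b) / a, (c - b) / a[%classic.
    apply/seteqP; split=> x /=; rewrite !in_itv /= /f.
      by rewrite ler_ndivrMr // ltr_ndivlMr // lerBrDr ltrBlDr mulrC => /andP[-> ->].
    by rewrite ler_ndivrMr // ltr_ndivlMr // lerBrDr ltrBlDr mulrC => /andP[-> ->].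
  rewrite !lebesgue_measure_itv /= !lte_fin ltr_nM2r ?invr_lt0 // ltrBlDr subrK.
  case: ifP => _; last by rewrite mule0.
  by rewrite -!EFinB -EFinM ltr0_norm // -mulrBl mulrCA mulNr divff // ?mulrN1; congr EFin; ring.
- have -> : [set x : R | (c < f x <= d)%R] = `](c - b) / a, (d - b) / a]%classic.
    apply/seteqP; split=> x /=; rewrite !in_itv /= /f.
      by rewrite ltr_pdivrMr // ler_pdivlMr // ltrBlDr lerBrDr mulrC => /andP[-> ->].
    by rewrite ltr_pdivrMr // ler_pdivlMr // ltrBlDr lerBrDr mulrC => /andP[-> ->].
  rewrite !lebesgue_measure_itv /= !lte_fin ltr_pM2r ?invr_gt0 // ltrBlDr subrK.
  case: ifP => _; last by rewrite mule0.
  by rewrite -!EFinB -EFinM gtr0_norm // -mulrBl mulrCA divff // mulr1; congr EFin; ring.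
Qed.

(** Fubini: every section of the preimage is the preimage of a section. *)
Lemma skew_snd (R : realType) (d1 d2 : measure_display) (T1 : measurableType d1)
    (T2 : measurableType d2) (m1 : {measure set T1 -> \bar R})
    (m2 : {sigma_finite_measure set T2 -> \bar R})
    (phi : T1 -> T2 -> T2) (k : R) (E : set (T1 * T2)) : 0 <= k ->
    (forall x B, measurable B -> m2 (phi x @^-1` B) = (k%:E * m2 B)%E) ->
    measurable E ->
  (m1 \x m2)%E ((fun p => (p.1, phi p.1 p.2)) @^-1` E) =
  (k%:E * (m1 \x m2)%E E)%E.
Proof.
move=> k0 mphi mE; rewrite /product_measure1 -ge0_integralZl_EFin //.
- apply: eq_integral => x _ /=; rewrite -(mphi x); last exact: measurable_xsection.
  congr (m2 _); apply/seteqP; split=> y /=; rewrite /xsection /= !inE //.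
- exact: measurable_fun_xsection.
Qed.

(** Both sides agree on rectangles, which determine a product measure. *)
Lemma product_measureC (R : realType) (d1 d2 : measure_display)
    (T1 : measurableType d1) (T2 : measurableType d2)
    (m1 : {sigma_finite_measure set T1 -> \bar R})
    (m2 : {sigma_finite_measure set T2 -> \bar R}) (E : set (T1 * T2)) :
  measurable E -> (m1 \x m2)%E E = (m1 \x^ m2)%E E.
Proof.
apply: product_measure_unique => A B mA mB; exact: product_measure2E.
Qed.

Lemma skew_fst (R : realType) (d1 d2 : measure_display) (T1 : measurableType d1)
    (T2 : measurableType d2) (m1 : {sigma_finite_measure set T1 -> \bar R})
    (m2 : {sigma_finite_measure set T2 -> \bar R})
    (phi : T2 -> T1 -> T1) (k : R) (E : set (T1 * T2)) : 0 <= k ->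
    (forall y A, measurable A -> m1 (phi y @^-1` A) = (k%:E * m1 A)%E) ->
    measurable_fun setT (fun p : T1 * T2 => (phi p.2 p.1, p.2)) ->
    measurable E ->
  (m1 \x m2)%E ((fun p => (phi p.2 p.1, p.2)) @^-1` E) =
  (k%:E * (m1 \x m2)%E E)%E.
Proof.
move=> k0 mphi mF mE; rewrite !product_measureC //; last first.
  by rewrite -[X in measurable X]setTI; apply: mF.
rewrite /product_measure2 -ge0_integralZl_EFin //.
- apply: eq_integral => y _ /=; rewrite -(mphi y); last exact: measurable_ysection.
  congr (m1 _); apply/seteqP; split=> x /=; rewrite /ysection /= !inE //.
- exact: measurable_fun_ysection.
Qed.

(** A name of its own lets the product carry a sigma-finite structure, which
    a further product requires. *)
Definition area (R : realType) : set (measurableTypeR R * measurableTypeR R) -> \bar R :=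
  (@lebesgue_measure R \x @lebesgue_measure R)%E.

HB.instance Definition _ (R : realType) := Measure.on (@area R).

Lemma area_sigma_finite (R : realType) : sigma_finite setT (@area R).
Proof.
have /sigma_finiteP[F [TF ndF Foo]] := sigma_finiteT (@lebesgue_measure R).
exists (fun n => F n `*` F n).
  rewrite -setXTT TF predeqE => -[x y]; split.
    move=> [/= [n _ Fnx] [k _ Gky]]; exists (maxn n k) => //; split.
    - by move: x Fnx; apply/subsetPset/ndF/leq_maxl.
    - by move: y Gky; apply/subsetPset/ndF/leq_maxr.
  by move=> [n _ []/= ? ?]; split; exists n.
move=> k; have [? ?] := Foo k; split; first exact: measurableX.
by rewrite /area product_measure1E // lte_mul_pinfty // ge0_fin_numE.
Qed.

HB.instance Definition _ (R : realType) :=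
  Measure_isSigmaFinite.Build _ _ _ (@area R) (@area_sigma_finite R).

Definition volume (R : realType) :
    set (measurableTypeR R * measurableTypeR R * measurableTypeR R) -> \bar R :=
  (@area R \x @lebesgue_measure R)%E.

HB.instance Definition _ (R : realType) := Measure.on (@volume R).

Lemma measurable_fun_affine (R : realType) (a b c d : R) :
  measurable_fun setT
    (fun p : R * R * R => a * p.1.1 + b * p.1.2 + c * p.2 + d).
Proof.
have m1 : measurable_fun setT (fun p : R * R * R => p.1.1).
  exact: measurableT_comp measurable_fst measurable_fst.
have m2 : measurable_fun setT (fun p : R * R * R => p.1.2).
  exact: measurableT_comp measurable_snd measurable_fst.
have m3 : measurable_fun setT (fun p : R * R * R => p.2) by exact: measurable_snd.
by do 3?[apply: measurable_funD => //]; apply: measurable_funM.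
Qed.

Definition shear_x (R : realType) (a b c d : R) (p : R * R * R) : R * R * R :=
  (a * p.1.1 + b * p.1.2 + c * p.2 + d, p.1.2, p.2).
Definition shear_y (R : realType) (a b c d : R) (p : R * R * R) : R * R * R :=
  (p.1.1, a * p.1.1 + b * p.1.2 + c * p.2 + d, p.2).
Definition shear_z (R : realType) (a b c d : R) (p : R * R * R) : R * R * R :=
  (p.1.1, p.1.2, a * p.1.1 + b * p.1.2 + c * p.2 + d).

Definition scales (R : realType) (f : R * R * R -> R * R * R) (k : R) : Prop :=
  measurable_fun setT f /\
  forall E, measurable E -> volume (f @^-1` E) = (k%:E * volume E)%E.

Lemma scales_comp (R : realType) (f g : R * R * R -> R * R * R) (k l : R) :
  scales f k -> scales g l -> scales (f \o g) (l * k).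
Proof.
move=> [mf fk] [mg gl]; split; first exact: measurableT_comp.
move=> E mE; rewrite comp_preimage gl; last first.
  by rewrite -[X in measurable X]setTI; apply: mf.
by rewrite fk // muleA EFinM.
Qed.

Lemma shear_x_scales (R : realType) (a b c d : R) :
  a != 0 -> scales (shear_x a b c d) `|a|^-1.
Proof.
move=> a0; have k0 : 0 <= `|a|^-1 by rewrite invr_ge0.
have mF : measurable_fun setT (shear_x a b c d).
  apply: measurable_fun_pair; last exact: measurable_snd.
  apply: measurable_fun_pair; first exact: measurable_fun_affine.
  exact: measurableT_comp measurable_snd measurable_fst.
split=> // E mE.
have := @skew_fst R _ _ _ _ (@area R)
  (@lebesgue_measure R)
  (fun z q => (a * q.1 + b * q.2 + c * z + d, q.2)) _ E k0 _ mF mE.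
apply => z A mA.
have mG : measurable_fun setT (fun q : R * R => (a * q.1 + (b * q.2 + c * z + d), q.2)).
  apply: measurable_fun_pair; last exact: measurable_snd.
  have m1 : measurable_fun setT (fun p : R * R => p.1) by exact: measurable_fst.
  have m2 : measurable_fun setT (fun p : R * R => p.2) by exact: measurable_snd.
  by do 3?[apply: measurable_funD => //]; apply: measurable_funM.
have := @skew_fst R _ _ _ _ (@lebesgue_measure R) (@lebesgue_measure R)
  (fun y x => a * x + (b * y + c * z + d)) _ A k0 _ mG mA.
move=> /(_ (fun y A mA => lebesgue_affine _ a0 mA)) <-.
by congr (_ _); apply/seteqP; split=> q /=; rewrite !addrA.
Qed.

Lemma shear_y_scales (R : realType) (a b c d : R) :
  b != 0 -> scales (shear_y a b c d) `|b|^-1.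
Proof.
move=> b0; have k0 : 0 <= `|b|^-1 by rewrite invr_ge0.
have mF : measurable_fun setT (shear_y a b c d).
  apply: measurable_fun_pair; last exact: measurable_snd.
  apply: measurable_fun_pair; last exact: measurable_fun_affine.
  exact: measurableT_comp measurable_fst measurable_fst.
split=> // E mE.
have := @skew_fst R _ _ _ _ (@area R) (@lebesgue_measure R)
  (fun z q => (q.1, a * q.1 + b * q.2 + c * z + d)) _ E k0 _ mF mE.
apply => z A mA.
have := @skew_snd R _ _ _ _ (@lebesgue_measure R) (@lebesgue_measure R)
  (fun x y => b * y + (a * x + c * z + d)) _ A k0.
move=> /(_ (fun x A mA => lebesgue_affine _ b0 mA) mA) <-.
by congr (_ _); apply/seteqP; split=> q /=;
  rewrite (_ : a * q.1 + b * q.2 + c * z + d = b * q.2 + (a * q.1 + c * z + d)) //; ring.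
Qed.

Lemma shear_z_scales (R : realType) (a b c d : R) :
  c != 0 -> scales (shear_z a b c d) `|c|^-1.
Proof.
move=> c0; have k0 : 0 <= `|c|^-1 by rewrite invr_ge0.
have mF : measurable_fun setT (shear_z a b c d).
  apply: measurable_fun_pair; last exact: measurable_fun_affine.
  apply: measurable_fun_pair.
    exact: measurableT_comp measurable_fst measurable_fst.
  exact: measurableT_comp measurable_snd measurable_fst.
split=> // E mE.
have := @skew_snd R _ _ _ _ (@area R) (@lebesgue_measure R)
  (fun p z => c * z + (a * p.1 + b * p.2 + d)) _ E k0.
move=> /(_ (fun x A mA => lebesgue_affine _ c0 mA) mE) <-.
by congr (_ _); apply/seteqP; split=> -[[x y] z] /=;
  rewrite /shear_z /= (_ : a * x + b * y + c * z + d = c * z + (a * x + b * y + d)) //; ring.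
Qed.

(** The affine map that sends the standard frame at the origin to the frame
    [u], [v], [w] at [q]. *)
Definition affine3 (R : realType) (q u v w p : R * R * R) : R * R * R :=
  (q.1.1 + p.1.1 * u.1.1 + p.1.2 * v.1.1 + p.2 * w.1.1,
   q.1.2 + p.1.1 * u.1.2 + p.1.2 * v.1.2 + p.2 * w.1.2,
   q.2 + p.1.1 * u.2 + p.1.2 * v.2 + p.2 * w.2).

Definition minor2 (R : realType) (u v : R * R * R) : R :=
  u.1.1 * v.1.2 - v.1.1 * u.1.2.

Definition detR (R : realType) (u v w : R * R * R) : R :=
  u.1.1 * (v.1.2 * w.2 - v.2 * w.1.2) - u.1.2 * (v.1.1 * w.2 - v.2 * w.1.1)
  + u.2 * (v.1.1 * w.1.2 - v.1.2 * w.1.1).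

(** Gaussian elimination without pivoting: the nonvanishing leading minors
    are the successive pivots. *)
Lemma affine3_scales (R : realType) (q u v w : R * R * R) :
    u.1.1 != 0 -> minor2 u v != 0 -> detR u v w != 0 ->
  scales (affine3 q u v w) `|detR u v w|^-1.
Proof.
case: q u v w => [[q1 q2] q3] [[u1 u2] u3] [[v1 v2] v3] [[w1 w2] w3] /= u0 m0 d0.
set m := minor2 _ _ in m0; set d := detR _ _ _ in d0 *.
pose A := (u3 * v2 - v3 * u2) / m; pose B := (u1 * v3 - v1 * u3) / m.
have eG : affine3 (q1, q2, q3) (u1, u2, u3) (v1, v2, v3) (w1, w2, w3) =
    shear_z A B (d / m) (q3 - A * q1 - B * q2) \o
    (shear_y (u2 / u1) (m / u1) (w2 - u2 * w1 / u1) (q2 - u2 * q1 / u1) \o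
     shear_x u1 v1 w1 q1).
  apply/funext => -[[x y] z]; rewrite /affine3 /shear_x /shear_y /shear_z /A /B /=.
  congr (_, _, _); rewrite /d /m /detR /minor2 /=.
  - by ring.
  - by field.
  - by field; rewrite ?u0 ?andbT.
have -> : `|d|^-1 = `|u1|^-1 * `|m / u1|^-1 * `|d / m|^-1.
  rewrite -!normfV -!normrM; congr `|_|.
  by field; rewrite ?u0 ?m0 ?d0.
rewrite eG; apply: scales_comp; first by apply: shear_z_scales; rewrite mulf_neq0 ?invr_eq0.
apply: scales_comp; first by apply: shear_y_scales; rewrite mulf_neq0 ?invr_eq0.
exact: shear_x_scales.
Qed.

(** Cramer's rule. *)
Definition affine3_inv (R : realType) (q u v w p : R * R * R) : R * R * R :=
  let r := (p.1.1 - q.1.1, p.1.2 - q.1.2, p.2 - q.2) in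
  (detR r v w / detR u v w, detR u r w / detR u v w, detR u v r / detR u v w).

Lemma affine3K (R : realType) (q u v w : R * R * R) : detR u v w != 0 ->
  cancel (affine3 q u v w) (affine3_inv q u v w).
Proof.
case: q u v w => [[q1 q2] q3] [[u1 u2] u3] [[v1 v2] v3] [[w1 w2] w3] d0 [[x y] z].
rewrite /affine3_inv /affine3 /=; move: d0; rewrite /detR /= => d0.
by congr (_, _, _); field.
Qed.

Lemma affine3_invK (R : realType) (q u v w : R * R * R) : detR u v w != 0 ->
  cancel (affine3_inv q u v w) (affine3 q u v w).
Proof.
case: q u v w => [[q1 q2] q3] [[u1 u2] u3] [[v1 v2] v3] [[w1 w2] w3] d0 [[x y] z].
rewrite /affine3_inv /affine3 /=; move: d0; rewrite /detR /= => d0.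
by congr (_, _, _); field.
Qed.

(** [affine3_scales] speaks of preimages; apply it to the image of [E], which
    is measurable as the preimage of [E] under the inverse map. *)
Lemma affine3_image (R : realType) (q u v w : R * R * R) (E : set (R * R * R)) :
    u.1.1 != 0 -> minor2 u v != 0 -> detR u v w != 0 -> measurable E ->
  measurable (affine3 q u v w @` E) /\
  volume (affine3 q u v w @` E) = (`|detR u v w|%:E * volume E)%E.
Proof.
move=> u0 m0 d0 mE; set G := affine3 q u v w; set H := affine3_inv q u v w.
have GH : G @` E = H @^-1` E.
  apply/seteqP; split=> [_ [p Ep <-]|p /= Ep]; first by rewrite /= /G /H affine3K.
  by exists (H p) => //; apply: affine3_invK.
have mG : measurable (G @` E).
  rewrite GH -[X in measurable X]setTI.
  have m1 : measurable_fun setT (fun p : R * R * R => p.1.1).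
    exact: measurableT_comp measurable_fst measurable_fst.
  have m2 : measurable_fun setT (fun p : R * R * R => p.1.2).
    exact: measurableT_comp measurable_snd measurable_fst.
  have m3 : measurable_fun setT (fun p : R * R * R => p.2) by exact: measurable_snd.
  suff : measurable_fun setT H by apply.
  rewrite /H /affine3_inv /detR /=.
  by do 2?[apply: measurable_fun_pair];
    repeat first [exact: m1 | exact: m2 | exact: m3 | exact: measurable_cst
      | apply: measurable_funM | apply: measurable_funB | apply: measurable_funD].
split=> //; have [_ /(_ _ mG)] := affine3_scales q u0 m0 d0.
rewrite -/G (_ : G @^-1` (G @` E) = E); last first.
  apply/seteqP; split=> [p [p' Ep']|p Ep]; last by exists p.
  by move/(can_inj (affine3K q d0)) <-.
by move=> ->; rewrite muleA -EFinM divff ?normr_eq0 // mul1e.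
Qed.

(** * The volume of the standard simplex *)

Lemma integral_power (R : realType) (t : R) (n : nat) : 0 < t ->
  (\int[@lebesgue_measure R]_(x in `]0%R, t[) ((t - x) ^+ n)%:E)%E =
  (t ^+ n.+1 / n.+1%:R)%:E.
Proof.
move=> t0; pose F (x : R) : R := - n.+1%:R^-1 * (t - x) ^+ n.+1.
have n0 : n.+1%:R != 0 :> R by rewrite pnatr_eq0.
have dF (x : R) : is_derive x 1 F ((t - x) ^+ n).
  have -> : F = - n.+1%:R^-1 \*: (cst t - id : R -> R) ^+ n.+1.
    by apply/funext => y; rewrite /F fctE.
  apply: is_derive_eq; rewrite /GRing.scale /=. rewrite !fctE.
  by field.
have cf : continuous (fun x : R => (t - x) ^+ n).
  have -> : (fun x => (t - x) ^+ n) = (cst t - id : R -> R) ^+ n.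
    by apply/funext => y; rewrite fctE.
  by move=> x; apply/differentiable_continuous/derivable1_diffP; apply: ex_derive.
have cF : continuous F.
  by move=> x; apply/differentiable_continuous/derivable1_diffP; case: (dF x).
rewrite -[LHS](@integral_itv_bndoo _ _ _ _ true false); last first.
  apply/measurable_EFinP; apply: subspace_continuous_measurable_fun => //.
  exact: continuous_subspaceT.
rewrite (@continuous_FTC2 _ _ F) //.
- by rewrite /F subrr subr0 expr0n mulr0 -EFinB sub0r mulNr opprK mulrC.
- exact: continuous_subspaceT.
- split=> [x _||]; first by case: (dF x).
  + by apply: cvg_at_right_filter; apply: cF.
  + by apply: cvg_at_left_filter; apply: cF.
- by move=> x _; rewrite derive1E; apply: derive_val.
Qed.

Definition open_triangle (R : realType) (t : R) : set (R * R) :=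
  [set q | [/\ 0 < q.1, 0 < q.2 & q.1 + q.2 < t]].

(** Open simplices are used for lower bounds on volumes: those of the facets
    of a triangulation are disjoint. *)
Definition open_simplex (R : realType) : set (R * R * R) :=
  [set p | [/\ 0 < p.1.1, 0 < p.1.2, 0 < p.2 & p.1.1 + p.1.2 + p.2 < 1]].
Arguments open_simplex : clear implicits.

Definition simplex (R : realType) : set (R * R * R) :=
  [set p | [/\ 0 <= p.1.1, 0 <= p.1.2, 0 <= p.2 & p.1.1 + p.1.2 + p.2 <= 1]].
Arguments simplex : clear implicits.

Lemma measurable_lt (R : realType) (d : measure_display) (T : measurableType d)
    (f g : T -> R) :
  measurable_fun setT f -> measurable_fun setT g ->
  measurable [set p | f p < g p].
Proof.
move=> mf mg; have := measurable_funB mg mf.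
move=> /(_ measurableT `]0, +oo[%classic (measurable_itv _)).
rewrite setTI; congr measurable; apply/seteqP; split=> p /=.
  by rewrite in_itv /= andbT subr_gt0.
by rewrite in_itv /= andbT subr_gt0.
Qed.

Lemma measurable_le (R : realType) (d : measure_display) (T : measurableType d)
    (f g : T -> R) :
  measurable_fun setT f -> measurable_fun setT g ->
  measurable [set p | f p <= g p].
Proof.
move=> mf mg; have := measurable_funB mg mf.
move=> /(_ measurableT `[0, +oo[%classic (measurable_itv _)).
rewrite setTI; congr measurable; apply/seteqP; split=> p /=.
  by rewrite in_itv /= andbT subr_ge0.
by rewrite in_itv /= andbT subr_ge0.
Qed.

Lemma measurable_triangle (R : realType) (t : R) : measurable (open_triangle t).
Proof.
have m1 : measurable_fun setT (fun p : R * R => p.1) by exact: measurable_fst.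
have m2 : measurable_fun setT (fun p : R * R => p.2) by exact: measurable_snd.
rewrite (_ : open_triangle t = [set q | 0 < q.1] `&` [set q | 0 < q.2] `&`
   [set q | q.1 + q.2 < t]); last by apply/seteqP; split=> q /=; [case|case=> -[]].
by apply: measurableI; [apply: measurableI|]; apply: measurable_lt => //;
  apply: measurable_funD.
Qed.

Lemma measurable_coords (R : realType) :
  [/\ measurable_fun setT (fun p : R * R * R => p.1.1),
      measurable_fun setT (fun p : R * R * R => p.1.2)
    & measurable_fun setT (fun p : R * R * R => p.2)].
Proof.
split; last exact: measurable_snd.
  exact: measurableT_comp measurable_fst measurable_fst.
exact: measurableT_comp measurable_snd measurable_fst.
Qed.

Lemma measurable_open_simplex (R : realType) : measurable (open_simplex R).
Proof.
have [m1 m2 m3] := measurable_coords R.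
rewrite (_ : open_simplex R = [set q | 0 < q.1.1] `&` [set q | 0 < q.1.2] `&`
   [set q | 0 < q.2] `&` [set q | q.1.1 + q.1.2 + q.2 < 1]); last first.
  by apply/seteqP; split=> q /=; [case|case=> -[[]]].
do 3?[apply: measurableI]; apply: measurable_lt => //.
by do 2?[apply: measurable_funD => //].
Qed.

Lemma measurable_simplex (R : realType) : measurable (simplex R).
Proof.
have [m1 m2 m3] := measurable_coords R.
rewrite (_ : simplex R = [set q | 0 <= q.1.1] `&` [set q | 0 <= q.1.2] `&`
   [set q | 0 <= q.2] `&` [set q | q.1.1 + q.1.2 + q.2 <= 1]); last first.
  by apply/seteqP; split=> q /=; [case|case=> -[[]]].
do 3?[apply: measurableI]; apply: measurable_le => //.
by do 2?[apply: measurable_funD => //].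
Qed.

Lemma area_triangle (R : realType) (t : R) : 0 < t ->
  area (open_triangle t) = (t ^+ 2 / 2%:R)%:E.
Proof.
move=> t0; have -> : area (open_triangle t) =
    (@lebesgue_measure R \x^ @lebesgue_measure R)%E (open_triangle t).
  by apply: product_measureC; apply: measurable_triangle.
rewrite -(integral_power 1 t0) [RHS]integral_mkcond; apply: eq_integral => y _.
rewrite /= patchE; case: ifPn => [|yt].
  rewrite inE /= in_itv /= => /andP[y0 yt].
  rewrite (_ : ysection _ y = `]0%R, t - y[); last first.
    apply/seteqP; split=> x /=; rewrite /ysection /= inE in_itv /=.
      by case=> /= x0 _ xyt; rewrite x0 ltrBrDr.
    by move=> /andP[x0 xyt]; split=> //=; rewrite -ltrBrDr.
  by rewrite lebesgue_measure_itv /= lte_fin subr_gt0 yt sube0 expr1.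
rewrite (_ : ysection _ y = set0) ?measure0 //; apply/seteqP; split=> x //=.
rewrite /ysection /= inE => -[/= x0 y0 xyt]; case/negP: yt; rewrite inE /= in_itv /=.
by rewrite y0 (le_lt_trans _ xyt) // lerDr ltW.
Qed.

(** Cavalieri: the section at height [z] is a triangle of size [1 - z]. *)
Lemma vol_open_simplex (R : realType) : volume (open_simplex R) = (6%:R^-1)%:E.
Proof.
have -> : volume (open_simplex R) =
    (@area R \x^ @lebesgue_measure R)%E (open_simplex R).
  by apply: product_measureC; apply: measurable_open_simplex.
transitivity (\int[@lebesgue_measure R]_(z in `]0%R, 1%R[)
   (2%:R^-1%:E * ((1 - z) ^+ 2)%:E))%E.
  rewrite [RHS]integral_mkcond; apply: eq_integral => z _.
  rewrite /= patchE; case: ifPn => [|z1].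
    rewrite inE /= in_itv /= => /andP[z0 z1].
    rewrite -EFinM mulrC -area_triangle ?subr_gt0 //; congr area.
    apply/seteqP; split=> q /=; rewrite /ysection /= inE.
      by case=> /= q0 q1 _ qz; split=> //=; rewrite ltrBrDr.
    by case=> /= q0 q1 qz; split=> //=; rewrite -ltrBrDr.
  rewrite (_ : ysection _ z = set0) ?measure0 //; apply/seteqP; split=> q //=.
  rewrite /ysection /= inE => -[/= q0 q1 z0 qz]; case/negP: z1.
  rewrite inE /= in_itv /= z0 (le_lt_trans _ qz) // lerDr.
  by rewrite addr_ge0 // ltW.
rewrite ge0_integralZl_EFin ?invr_ge0 //.
- by rewrite integral_power // expr1n -EFinM; congr EFin; field.
- by move=> z _; rewrite lee_fin sqr_ge0.
- apply/measurable_EFinP; apply: measurable_funX; apply: measurable_funB => //.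
Qed.

Lemma open_simplex_sub (R : realType) : open_simplex R `<=` simplex R.
Proof. by move=> p [/ltW ? /ltW ? /ltW ? /ltW ?]. Qed.

(** The closed simplex lies in a homothetic copy of the open one, with ratio
    as close to 1 as desired. *)
Lemma vol_simplex (R : realType) : volume (simplex R) = (6%:R^-1)%:E.
Proof.
apply/eqP; rewrite eq_le; apply/andP; split; last first.
  rewrite -vol_open_simplex; apply: le_measure; rewrite ?inE;
    [exact: measurable_open_simplex|exact: measurable_simplex|exact: open_simplex_sub].
apply/lee_addgt0Pr => e e0.
(* Translating by - dl and scaling by 1 + 4 dl makes all four inequalities
   strict; the volume grows by at most 100 dl. *)
pose dl : R := Num.min 1 e / 100%:R.
have dl0 : 0 < dl by rewrite divr_gt0 // lt_min ltr01 e0.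
pose r := 1 + 4 * dl; have r0 : 0 < r by rewrite addr_gt0 // mulr_gt0.
pose G := affine3 (- dl, - dl, - dl) (r, 0, 0) (0, r, 0) (0, 0, r).
have dG : detR (r, 0, 0) (0, r, 0) (0, 0, r) = r ^+ 3 by rewrite /detR /=; ring.
have [|||mG vG] := @affine3_image R (- dl, - dl, - dl) (r, 0, 0) (0, r, 0) (0, 0, r)
  (open_simplex R) _ _ _ (@measurable_open_simplex R).
- by rewrite /= gt_eqF.
- by rewrite /minor2 /= !mul0r subr0 mulf_neq0 // gt_eqF.
- by rewrite dG expf_neq0 // gt_eqF.
apply: (@le_trans _ _ (volume (G @` open_simplex R))).
  apply: le_measure; rewrite ?inE //; first exact: measurable_simplex.
  move=> [[x y] z] [/= x0 y0 z0 xyz].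
  exists ((x + dl) / r, (y + dl) / r, (z + dl) / r).
    have pos a : 0 <= a -> 0 < (a + dl) / r by move=> a0; apply: divr_gt0 => //; apply: ltr_wpDl.
    split=> /=; [exact: pos|exact: pos|exact: pos|].
    by rewrite -!mulrDl ltr_pdivrMr // mul1r /r; move: xyz dl0; clear; lra.
  by rewrite /G /affine3 /=; congr (_, _, _); field; rewrite gt_eqF.
rewrite vG dG vol_open_simplex -EFinM -EFinD lee_fin ger0_norm ?exprn_ge0 ?ltW //.
have d1 : dl <= 100%:R^-1 by rewrite ler_pdivrMr // mulVf // ge_min lexx.
have de : dl * 100 <= e by rewrite divfK // ge_min lexx orbT.
move: d1 de dl0; rewrite /r; clear; move: dl => x; nra.
Qed.

(** * The volume of a lattice tetrahedron *)

Definition edge (i j : nat) : seq int :=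
  [seq expz j d - expz i d | d <- iota 0 3].

Definition edge_det (r : seq nat) : int :=
  let i := nth 0%N r 0 in
  det3 (edge i (nth 0%N r 1)) (edge i (nth 0%N r 2)) (edge i (nth 0%N r 3)).

(** The leading minors of the edge matrix do not vanish; by elimination every
    tetrahedron has an ordering of its vertices for which this holds. *)
Definition pivot_ok (r : seq nat) : bool :=
  let u := edge (nth 0%N r 0) (nth 0%N r 1) in
  let v := edge (nth 0%N r 0) (nth 0%N r 2) in
  [&& u`_0 != 0, u`_0 * v`_1 - v`_0 * u`_1 != 0 & edge_det r != 0].

Definition pivot (b : bitseq) : seq nat :=
  nth [::] [seq r <- permutations (support b) | pivot_ok r] 0.

Definition tet_volume (b : bitseq) : nat := `|edge_det (pivot b)|%N.

Lemma pivot_exists : all (fun b => has pivot_ok (permutations (support b))) bases.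
Proof. by vm_compute. Qed.

Lemma pivotP (b : bitseq) : b \in bases ->
  perm_eq (pivot b) (support b) /\ pivot_ok (pivot b).
Proof.
move=> bb; have := allP pivot_exists b bb; rewrite has_filter /pivot.
set l := [seq r <- _ | _] => l0.
have : nth [::] l 0 \in l by rewrite mem_nth // lt0n size_eq0.
by rewrite mem_filter mem_permutations => /andP[ok ->]; split.
Qed.

Definition open_hull (R : realType) (s : {set 'I_8}) : set 'rV[R]_4 :=
  [set x | exists c : 'I_8 -> R,
     [/\ forall i, i \in s -> 0 < c i, \sum_(i in s) c i = 1
       & x = \sum_(i in s) c i *: pt R i]].
Arguments open_hull : clear implicits.

Definition edgeR (R : realType) (z : seq int) : R * R * R :=
  ((z`_0)%:~R, (z`_1)%:~R, (z`_2)%:~R).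
Arguments edgeR : clear implicits.

Definition ptR (R : realType) (i : nat) : R * R * R :=
  ((expz i 0)%:~R, (expz i 1)%:~R, (expz i 2)%:~R).
Arguments ptR : clear implicits.

Definition tet_map (R : realType) (r : seq nat) : R * R * R -> R * R * R :=
  let i := nth 0%N r 0 in
  affine3 (ptR R i) (edgeR R (edge i (nth 0%N r 1)))
    (edgeR R (edge i (nth 0%N r 2))) (edgeR R (edge i (nth 0%N r 3))).
Arguments tet_map : clear implicits.

Lemma sum_vertices (V : nmodType) (s : {set 'I_8}) (r : seq nat) (F : 'I_8 -> V) :
    perm_eq r (support (mask_of s)) ->
  \sum_(i in s) F i = \sum_(k <- r) F (inord k).
Proof.
move=> rs; have ur : uniq r by rewrite (perm_uniq rs) filter_uniq ?iota_uniq.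
have r8 k : k \in r -> (k < 8)%N.
  by rewrite (perm_mem rs) mem_filter mem_iota => /and3P[].
rewrite -(big_map (fun k => inord k : 'I_8) predT F) big_uniq /=; last first.
  rewrite map_inj_in_uniq // => i j ir jr /(congr1 val).
  by rewrite /= !inordK ?r8.
apply: eq_bigl => i; rewrite -nth_mask_of -mem_support -(perm_mem rs).
apply/idP/mapP => [ir|[k kr ->]]; first by exists (i : nat); rewrite ?inord_val.
by rewrite inordK ?r8.
Qed.

Lemma forget_w_comb (R : realType) (r : seq nat) (c : 'I_8 -> R) :
    (forall k, k \in r -> (k < 8)%N) -> size r = 4%N ->
    \sum_(k <- r) c (inord k) = 1 ->
  forget_w (\sum_(k <- r) c (inord k) *: pt R (inord k)) =
  tet_map R r (c (inord (nth 0%N r 1)), c (inord (nth 0%N r 2)),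
               c (inord (nth 0%N r 3))).
Proof.
case: r => [|i0 [|i1 [|i2 [|i3 []]]]] //= r8 _; rewrite !big_cons !big_nil !addr0.
move=> /(canRL (addrK _)); set c1 := c (inord i1); set c2 := c (inord i2).
set c3 := c (inord i3) => c0.
rewrite /forget_w !mxE c0 /expo !inordK ?r8 ?inE ?eqxx ?orbT //.
rewrite /tet_map /affine3 /= /ptR /edgeR /edge /= !rmorphB /= /expz.
by congr (_, _, _); rewrite !pmulrn; ring.
Qed.

(** In barycentric coordinates; the coordinate of the first vertex is
    eliminated. *)
Lemma hull_tet (R : realType) (s : {set 'I_8}) (r : seq nat) :
    perm_eq r (support (mask_of s)) -> size r = 4%N ->
  @forget_w R @` hull R s = tet_map R r @` simplex R /\
  @forget_w R @` open_hull R s = tet_map R r @` open_simplex R.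
Proof.
move=> rs r4.
have r8 k : k \in r -> (k < 8)%N.
  by rewrite (perm_mem rs) mem_filter mem_iota => /and3P[].
have ur : uniq r by rewrite (perm_uniq rs) filter_uniq ?iota_uniq.
have rin k : k \in r -> inord k \in s.
  by move=> kr; rewrite -nth_mask_of -mem_support -(perm_mem rs) inordK ?r8.
have nin j : (j < 4)%N -> nth 0%N r j \in r by move=> j4; rewrite mem_nth ?r4.
(* The barycentric coordinates of the image of p, indexed by labels. *)
pose coef (p : R * R * R) (i : 'I_8) : R :=
  nth 0 [:: 1 - p.1.1 - p.1.2 - p.2; p.1.1; p.1.2; p.2] (index (i : nat) r).
have coefE p j : (j < 4)%N -> coef p (inord (nth 0%N r j)) =
    nth 0 [:: 1 - p.1.1 - p.1.2 - p.2; p.1.1; p.1.2; p.2] j.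
  by move=> j4; rewrite /coef inordK ?r8 ?nin // index_uniq ?r4.
have sum4 (F : nat -> R) : \sum_(k <- r) F k =
    F (nth 0%N r 0) + (F (nth 0%N r 1) + (F (nth 0%N r 2) + F (nth 0%N r 3))).
  by rewrite (big_nth 0%N) r4 /index_iota /= !big_cons big_nil addr0.
have sum_coef p : \sum_(i in s) coef p i = 1.
  by rewrite (sum_vertices _ rs) sum4 !coefE //=; ring.
have img p : forget_w (\sum_(i in s) coef p i *: pt R i) = tet_map R r p.
  rewrite (sum_vertices _ rs) forget_w_comb -?(sum_vertices _ rs) //.
  by rewrite !coefE //=; case: p => [[]].
have all_coef (P : R -> Prop) p i : i \in s -> (forall j, (j < 4)%N ->
   P (nth 0 [:: 1 - p.1.1 - p.1.2 - p.2; p.1.1; p.1.2; p.2] j)) -> P (coef p i).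
  move=> si; apply; rewrite -[X in (_ < X)%N]r4 index_mem (perm_mem rs) mem_support.
  by rewrite nth_mask_of.
split; apply/seteqP; split=> y.
- move=> [x [c [c0 c1 ->]] <-]; move: c1; rewrite !(sum_vertices _ rs) => c1.
  rewrite forget_w_comb //; eexists; last by [].
  split=> //=; rewrite -c1 sum4 -!addrA lerDr //.
- move=> [p [p1 p2 p3 p4] <-]; exists (\sum_(i in s) coef p i *: pt R i) => //.
  exists (fun i => if i \in s then coef p i else 0); split.
  + move=> i; case: ifP => // si; apply: (all_coef (fun z => 0 <= z)) => // j.
    case: j => [|[|[|[]]]] //= _; move: p4; move: p.1.1 p.1.2 p.2; clear - R => x1 x2 x3; lra.
  + by rewrite -(sum_coef p); apply: eq_bigr => i ->.
  + by apply: eq_bigr => i ->.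
- move=> [x [c [c0 c1 ->]] <-]; move: c1; rewrite !(sum_vertices _ rs) => c1.
  rewrite forget_w_comb //; eexists; last by [].
  by split=> /=; rewrite ?c0 ?rin ?nin // -c1 sum4 -!addrA ltrDr c0 ?rin ?nin.
- move=> [p [p1 p2 p3 p4] <-]; exists (\sum_(i in s) coef p i *: pt R i) => //.
  exists (coef p); split=> // i si; apply: (all_coef (fun z => 0 < z)) => // j.
  case: j => [|[|[|[]]]] //= _; move: p4; move: p.1.1 p.1.2 p.2; clear - R => x1 x2 x3; lra.
Qed.

Lemma vol_tet (R : realType) (s : {set 'I_8}) (E : set (R * R * R)) :
    mask_of s \in bases -> measurable E ->
  measurable (tet_map R (pivot (mask_of s)) @` E) /\
  volume (tet_map R (pivot (mask_of s)) @` E) =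
    ((tet_volume (mask_of s))%:R%:E * volume E)%E.
Proof.
move=> /pivotP[_ /and3P[u0 m0 d0]] mE; rewrite /tet_volume; set r := pivot _ in u0 m0 d0 *.
have detE a b c : detR (edgeR R a) (edgeR R b) (edgeR R c) = (det3 a b c)%:~R.
  by rewrite /det3 !(rmorphD, rmorphB, rmorphM) /detR /=; ring.
have [|||mG vG] := @affine3_image R (ptR R (nth 0%N r 0)) (edgeR R (edge (nth 0%N r 0)
  (nth 0%N r 1))) (edgeR R (edge (nth 0%N r 0) (nth 0%N r 2)))
  (edgeR R (edge (nth 0%N r 0) (nth 0%N r 3))) E _ _ _ mE.
- by rewrite /= intr_eq0.
- by rewrite /minor2 /= -!rmorphM -rmorphB intr_eq0.
- by rewrite detE intr_eq0.
split=> //; rewrite [LHS]vG detE; congr (_%:E * _)%E.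
by rewrite -/(edge_det r) -intr_norm -abszE pmulrn.
Qed.

Lemma nvol_basis (R : realType) (s : {set 'I_8}) : mask_of s \in bases ->
  [/\ measurable (@forget_w R @` hull R s), measurable (@forget_w R @` open_hull R s),
      nvol (hull R s) = (tet_volume (mask_of s))%:R%:E
    & volume (@forget_w R @` open_hull R s) = volume (@forget_w R @` hull R s)].
Proof.
move=> sb; have [rs _] := pivotP sb.
have r4 : size (pivot (mask_of s)) = 4%N.
  by rewrite (perm_size rs); move: sb; rewrite mem_filter => /andP[/andP[/eqP]].
have [-> ->] := hull_tet R rs r4.
have [mc vc] := vol_tet sb (@measurable_simplex R).
have [mo vo] := vol_tet sb (@measurable_open_simplex R).
split; [exact: mc|exact: mo| |]; last by rewrite vc vo vol_simplex vol_open_simplex.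
transitivity ((3`!)%:R%:E * volume (@forget_w R @` hull R s))%E; first by [].
have [-> _] := hull_tet R rs r4.
by rewrite vc vol_simplex -!EFinM; congr EFin; rewrite !factS fact0; field.
Qed.

(** * Vertices and dimension of the polytope *)

Lemma pt_polytope (R : realType) (i : 'I_8) : polytope R (pt R i).
Proof.
apply/hullP; exists (fun j => (j == i)%:R); split=> //.
- by move=> j; rewrite inE.
- by rewrite (bigD1 i) //= eqxx big1 ?addr0 // => j /negbTE ->.
- by rewrite (bigD1 i) //= eqxx scale1r big1 ?addr0 // => j /negbTE ->; rewrite scale0r.
Qed.

(** The [i]-th entry is maximal over the configuration only at the [i]-th
    point. *)
Definition vertex_functionals : seq (seq int) :=
  [:: [:: 0; 0; 1; -2]; [:: 0; 0; -2; 1]; [:: 1; -2; 0; 0]; [:: -2; 1; 0; 0];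
      [:: 1; 0; 0; 0]; [:: 0; 1; 0; 0]; [:: 0; 0; 1; 0]; [:: 0; 0; 0; 1]].

Lemma vertex_functionalsP (R : realType) (i : 'I_8) : exists u : 'rV[R]_4,
  forall j, j != i -> dotv u (pt R j) < dotv u (pt R i).
Proof.
exists (\row_j ((nth [::] vertex_functionals i)`_j)%:~R) => j ji.
rewrite !dot4_pt ltr_int.
have ok : all (fun i => all (fun j => (j == i) ||
   (dot4 (nth [::] vertex_functionals i) j < dot4 (nth [::] vertex_functionals i) i))
   (iota 0 8)) (iota 0 8) by vm_compute.
have /allP/(_ i) := ok; rewrite mem_iota leq0n ltn_ord => /(_ isT)/allP/(_ j).
by rewrite mem_iota leq0n ltn_ord -[_ == _]/(j == i) (negbTE ji) => /(_ isT).
Qed.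

(** A functional attains its maximum over the hull at one of the generating
    points, so a unique maximizer is one of them. *)
Lemma vertices_polytope (R : realType) : vertices (polytope R) = range (pt R).
Proof.
apply/seteqP; split=> [v [/hullP[c [c0 _ c1 cv]] [u uv]]|_ [i _ <-]].
  apply: contrapT => nv.
  have lt_v i : dotv u (pt R i) < dotv u v.
    by apply: uv; [exact: pt_polytope|move=> iv; apply: nv; exists i].
  have : \sum_i c i * (dotv u v - dotv u (pt R i)) = 0.
    under eq_bigr => i _ do rewrite mulrBr.
    by rewrite sumrB -mulr_suml c1 mul1r -dotv_sumr -cv subrr.
  move/eqP; rewrite psumr_eq0 => [/allP c_eq0|i _]; last first.
    by rewrite mulr_ge0 // subr_ge0 ltW.
  have : \sum_i c i = 0 :> R.
    apply: big1 => i _; have := c_eq0 i (mem_index_enum i).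
    by rewrite /= mulf_eq0 subr_eq0 (gt_eqF (lt_v i)) orbF => /eqP.
  by rewrite c1 => /eqP; rewrite oner_eq0.
split; first exact: pt_polytope.
have [u ui] := vertex_functionalsP R i; exists u => x /hullP[c [c0 _ c1 cx]] xi.
have ge0 j : 0 <= c j * (dotv u (pt R i) - dotv u (pt R j)).
  have [->|ji] := eqVneq j i; first by rewrite subrr mulr0.
  by rewrite mulr_ge0 // subr_ge0 ltW // ui.
have sumE : \sum_j c j * (dotv u (pt R i) - dotv u (pt R j)) =
    dotv u (pt R i) - dotv u x.
  under eq_bigr => j _ do rewrite mulrBr.
  by rewrite sumrB -mulr_suml c1 mul1r -dotv_sumr -cx.
rewrite -subr_gt0 -sumE lt_def sumr_ge0 // andbT psumr_eq0 //.
apply/negP => /allP c_eq0; apply: xi.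
have cj j : j != i -> c j = 0.
  move=> ji; have := c_eq0 j (mem_index_enum j); rewrite /= mulf_eq0 subr_eq0.
  by rewrite (gt_eqF (ui j ji)) orbF => /eqP.
have ci : c i = 1 by rewrite -c1 (bigD1 i) //= big1 ?addr0 // => j /cj.
rewrite cx (bigD1 i) //= ci scale1r big1 ?addr0 // => j /cj ->.
by rewrite scale0r.
Qed.

Definition first_four : {set 'I_8} := [set i : 'I_8 | (i < 4)%N]%SET.

Lemma first_four_dual (R : realType) : has_dual R first_four.
Proof.
apply: basis_dual.
have -> : mask_of first_four = nseq 4 true ++ nseq 4 false.
  apply: (@eq_from_nth _ false) => [|k]; first by rewrite size_mkseq.
  rewrite size_mkseq => k8; rewrite nth_mkseq // inE inordK //.
  by move: k k8; do 8![case=> //].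
by vm_compute.
Qed.

(** The first four points form an affine basis; the coefficients for the others
    are those of the circuits through three of them. *)
Lemma pt_diff (R : realType) (i : 'I_8) : exists a b c : R,
  pt R i - pt R (inord 0) = a *: (pt R (inord 1) - pt R (inord 0)) +
    b *: (pt R (inord 2) - pt R (inord 0)) +
    c *: (pt R (inord 3) - pt R (inord 0)).
Proof.
suff [a [b [c abc]]] : exists a b c : R, forall j : 'I_4,
    (expo i j)%:R - (expo (inord 0) j)%:R =
    a * ((expo (inord 1) j)%:R - (expo (inord 0) j)%:R) +
    b * ((expo (inord 2) j)%:R - (expo (inord 0) j)%:R) +
    c * ((expo (inord 3) j)%:R - (expo (inord 0) j)%:R) :> R.
  by exists a, b, c; apply/rowP => j; rewrite !mxE.
rewrite /expo !inordK //; case: i => -[|[|[|[|[|[|[|[|//]]]]]]]] /= _.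
- by exists 0, 0, 0 => j; ring.
- by exists 1, 0, 0 => j; ring.
- by exists 0, 1, 0 => j; ring.
- by exists 0, 0, 1 => j; ring.
- by exists 1, 0, (-1) => -[[|[|[|[|//]]]] ? /=]; ring.
- by exists 1, (-1), 0 => -[[|[|[|[|//]]]] ? /=]; ring.
- by exists (-1), 1, 1 => -[[|[|[|[|//]]]] ? /=]; ring.
- by exists 0, 1, 1 => -[[|[|[|[|//]]]] ? /=]; ring.
Qed.

Lemma dotvBr (R : realType) (u a b : 'rV[R]_4) :
  dotv u (a - b) = dotv u a - dotv u b.
Proof. by rewrite /dotv -sumrB; apply: eq_bigr => l _; rewrite !mxE mulrBr. Qed.

Lemma has_dim_polytope (R : realType) : has_dim (polytope R) 3.
Proof.
pose v (k : nat) := pt R (inord k) - pt R (inord 0).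
pose X := [tuple v 1; v 2; v 3].
have Xin k : (0 < k < 4)%N -> v k \in <<X>>%VS.
  by case: k => [|[|[|[]]]] // _; apply: memv_span; rewrite !inE eqxx ?orbT.
exists (pt R (inord 0)), <<X>>%VS; split.
- exact: pt_polytope.
- move=> x /hullP[c [_ _ c1 ->]].
  rewrite -[pt R (inord 0)]scale1r -c1 scaler_suml -sumrB.
  apply: memv_suml => i _; rewrite -scalerBr; apply: memvZ.
  have [a [b [d ->]]] := pt_diff R i.
  by apply: memvD; [apply: memvD|]; apply: memvZ;
    [exact: (Xin 1%N isT)|exact: (Xin 2%N isT)|exact: (Xin 3%N isT)].
- move=> U UP; apply/span_subvP => _ /tnthP[k ->].
  have /mapP[j _ ->] : tnth X k \in map v [:: 1; 2; 3]%N by apply: mem_tnth.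
  by apply: UP; apply: pt_polytope.
- apply/eqP; change (free X); apply/freeP => k kX i.
  have lt3 (j : 'I_3) : (j.+1 < 8)%N by rewrite ltnS (leq_trans (ltn_ord j)).
  have i4 : inord i.+1 \in first_four.
    by rewrite inE inordK ?lt3 //; exact: ltn_ord i.
  have [u ui] := @first_four_dual R _ i4.
  have uv (j : 'I_3) : dotv u X`_j = (i == j)%:R.
    have -> : X`_j = v j.+1 by case: j => -[|[|[]]].
    rewrite /v dotvBr !ui ?inE ?inordK ?lt3 //; first last.
      exact: ltn_ord j.
    by rewrite -!val_eqE /= !inordK ?lt3 // eqSS subr0.
  have := dotv_sumr predT u k (fun l : 'I_3 => X`_l); rewrite kX.
  have -> : dotv u 0 = 0 by rewrite -(subrr u) dotvBr subrr.
  rewrite (bigD1 i) //= uv eqxx mulr1 big1 ?addr0 // => j ji.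
  by rewrite uv eq_sym (negbTE ji) mulr0.
Qed.

(** * Facets, GKZ vectors and the volume of the polytope *)

Definition facets (M : seq bitseq) : seq bitseq := [seq b <- bases | face M b].

Lemma bases_masks (b : bitseq) : b \in bases -> b \in masks.
Proof. by rewrite mem_filter => /andP[]. Qed.

Lemma facetsP (M : seq bitseq) (b : bitseq) :
  (b \in facets M) = (b \in bases) && (set_of b \in complex M).
Proof.
rewrite /facets mem_filter finset.in_set andbC.
by case: (boolP (b \in bases)) => //= /bases_masks bm; rewrite mask_ofK.
Qed.

Lemma bases_uniq : uniq bases. Proof. by vm_compute. Qed.

Lemma card_support (s : {set 'I_8}) : #|s| = size (support (mask_of s)).
Proof.
have := @sum_vertices nat s _ (fun _ => 1%N) (perm_refl _).
rewrite sum1_card => ->; rewrite big_const_seq count_predT.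
by elim: (size _) => //= n ->.
Qed.

Lemma card_basis (s : {set 'I_8}) : mask_of s \in bases -> #|s| = 4%N.
Proof.
by rewrite card_support mem_filter => /andP[/andP[/eqP ->]].
Qed.

Lemma facet_mask (M : seq bitseq) (s : {set 'I_8}) : pure bases M ->
  (s \in complex M) && (#|s| == 4%N) = (mask_of s \in facets M).
Proof.
move=> pM; rewrite facetsP set_ofK.
apply/andP/andP => [[sM /eqP s4]|[sb sM]]; last by rewrite sM card_basis.
split=> //; have [t [tb tM st]] := pure_basis pM sM.
suff -> : s = t by [].
by apply/eqP; rewrite eqEcard st s4 card_basis.
Qed.

(** Replaces a sum over the faces of size 4 by one over a list that can be
    evaluated. *)
Lemma sum_facets (V : nmodType) (M : seq bitseq) (P : pred {set 'I_8})
    (F : {set 'I_8} -> V) : pure bases M ->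
  \sum_(s in complex M | (#|s| == 4%N) && P s) F s =
  \sum_(b <- facets M | P (set_of b)) F (set_of b).
Proof.
move=> pM; rewrite -(big_map set_of P F).
rewrite -[LHS]big_filter -[RHS]big_filter; apply: perm_big; apply: uniq_perm.
- by rewrite filter_uniq // index_enum_uniq.
- apply: filter_uniq; rewrite map_inj_in_uniq => [|b c].
    exact: filter_uniq bases_uniq.
  rewrite !facetsP => /andP[/bases_masks bb _] /andP[/bases_masks cb _].
  by move=> /(congr1 mask_of); rewrite !mask_ofK.
move=> s; rewrite !mem_filter mem_index_enum andbT andbA facet_mask // andbC.
congr (_ && _); apply/idP/mapP => [sF|[b bF ->]].
  by exists (mask_of s); rewrite ?set_ofK.
have /andP[/bases_masks bb _] : (b \in bases) && (set_of b \in complex M).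
  by rewrite -facetsP.
by rewrite mask_ofK.
Qed.

Lemma nvol_facet (R : realType) (M : seq bitseq) (b : bitseq) :
  b \in facets M -> nvol (hull R (set_of b)) = (tet_volume b)%:R%:E.
Proof.
rewrite facetsP => /andP[bb _]; have bm := bases_masks bb.
by have [|_ _ -> _] := @nvol_basis R (set_of b); rewrite mask_ofK.
Qed.

Lemma gkz_complex (R : realType) (w : seq int) (j : 'I_8) : admissible bases w ->
  gkz R (complex (nonfaces w)) j =
  (sumn [seq tet_volume b | b <- facets (nonfaces w) & nth false b j])%:R%:E.
Proof.
move=> /andP[_ pw]; rewrite /gkz (sum_facets (fun s => j \in s) _ pw).
rewrite sumnE big_map big_filter natr_sum -sumEFin [RHS]big_seq_cond.
rewrite [LHS]big_seq_cond; apply: eq_big => [b|b /andP[bF _]].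
  by rewrite finset.in_set.
exact: nvol_facet bF.
Qed.

Lemma unimodular_complex (R : realType) (w : seq int) : admissible bases w ->
  unimodular R (complex (nonfaces w)) <->
  all (fun b => tet_volume b == 1%N) (facets (nonfaces w)).
Proof.
move=> /andP[_ pw]; split=> [uni|/allP uni s sT s4].
  apply/allP => b bF; have := nvol_facet R bF.
  have := bF; rewrite facetsP => /andP[bb bT].
  rewrite (uni _ bT); last first.
    by apply: card_basis; rewrite (mask_ofK (bases_masks bb)).
  by move=> /eqP; rewrite eqe -[1]/(1%:R) eqr_nat eq_sym.
have sF : mask_of s \in facets (nonfaces w).
  by rewrite -facet_mask // sT s4 eqxx.
by have := nvol_facet R sF; rewrite set_ofK (eqP (uni _ sF)).
Qed.

Lemma hull_sum (R : realType) (s : {set 'I_8}) (x : 'rV[R]_4) :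
  hull R s x -> \sum_j x 0 j = 3%:R.
Proof.
move=> /hullP[c [_ _ c1 ->]].
have sum_pt i : \sum_j pt R i 0 j = 3%:R.
  have : all (fun i => sumn (nth [::] exponents i) == 3%N) (iota 0 8) by [].
  move=> /allP/(_ i); rewrite mem_iota leq0n ltn_ord => /(_ isT)/eqP s3.
  transitivity ((sumn (nth [::] exponents i))%:R : R); last by rewrite s3.
  have sz : size (nth [::] exponents i) = 4%N by case: (i) => -[|[|[|[|[|[|[|[|//]]]]]]]].
  rewrite sumnE (big_nth 0%N) sz big_mkord natr_sum; apply: eq_bigr => j _.
  by rewrite mxE.
under eq_bigr => j _ do rewrite summxE.
rewrite exchange_big /=; under eq_bigr => i _ do under eq_bigr => j _ do rewrite mxE.
under eq_bigr => i _ do rewrite -mulr_sumr sum_pt.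
by rewrite -mulr_suml c1 mul1r.
Qed.

(** On the plane of coordinate sum 3 the last coordinate is determined. *)
Lemma forget_w_inj (R : realType) (x y : 'rV[R]_4) :
  \sum_j x 0 j = 3%:R -> \sum_j y 0 j = 3%:R -> forget_w x = forget_w y -> x = y.
Proof.
rewrite !big_ord_recl !big_ord0 /forget_w.
have o1 : lift ord0 ord0 = 1 :> 'I_4 by apply/val_inj.
have o2 : lift ord0 (lift ord0 ord0) = 2%:R :> 'I_4 by apply/val_inj.
have o3 : lift ord0 (lift ord0 (lift ord0 ord0)) = 3%:R :> 'I_4.
  by apply/val_inj.
rewrite o3 o2 o1 => x3 y3 [e0 e1 e2].
have e3 : x 0 (3%:R) = y 0 (3%:R).
  move: x3 y3; rewrite -[ord0]/(0 : 'I_4) e0 e1 e2 => <- /addrI/addrI/addrI.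
  by rewrite !addr0 => ->.
apply/rowP => j.
have : j \in [:: 0; 1; 2%:R; 3%:R].
  by rewrite !inE -!val_eqE /=; case: j => -[|[|[|[|//]]]].
by rewrite !inE => /or4P[] /eqP ->.
Qed.

Lemma open_hull_sub (R : realType) (s : {set 'I_8}) : open_hull R s `<=` hull R s.
Proof.
move=> x [c [c0 c1 ->]]; exists (fun i => if i \in s then c i else 0); split.
- by move=> i; case: ifP => // /c0/ltW.
- by rewrite -c1; apply: eq_bigr => i ->.
- by apply: eq_bigr => i ->.
Qed.

(** The point lies in the hull of the intersection, where the coordinates at
    the vertices outside [t] vanish; in the open hull none vanishes. *)
Lemma open_hull_sub_face (R : realType) (T : {set {set 'I_8}}) (s t : {set 'I_8})
    (x : 'rV[R]_4) : triangulation R T -> s \in T -> t \in T ->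
  open_hull R s x -> hull R t x -> s \subset t.
Proof.
move=> [_ Tind TI _] sT tT xs xt.
have /seteqP[/(_ x (conj (open_hull_sub xs) xt)) /hullP[d [_ dst d1 dx]] _] :=
  TI s t sT tT.
move: xs => [c [c0 c1 cx]].
have ds (V : nmodType) (F : 'I_8 -> V) : (forall i, d i = 0 -> F i = 0) ->
    \sum_(i in s) F i = \sum_i F i.
  move=> F0; rewrite [RHS](bigID (mem s)) /= [X in _ + X]big1 ?addr0 // => i si.
  by apply: F0; apply: dst; rewrite inE (negbTE si).
apply/fintype.subsetP => i si; apply: contraT => it.
have : c i - d i = 0.
  apply: (Tind s sT (fun j => c j - d j)) => //.
    by rewrite sumrB c1 ds // d1 subrr.
  under eq_bigr => j _ do rewrite scalerBl.
  by rewrite sumrB -cx ds ?dx ?subrr // => j ->; rewrite scale0r.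
rewrite dst ?inE ?si // subr0 => ci0.
by have := c0 i si; rewrite ci0 ltxx.
Qed.

Lemma vol_bigcup_le (R : realType) (I : choiceType) (l : seq I) (A : I -> set (R * R * R)) :
    (forall i, i \in l -> measurable (A i)) ->
  measurable (\big[setU/set0]_(i <- l) A i) /\
  (volume (\big[setU/set0]_(i <- l) A i) <= \sum_(i <- l) volume (A i))%E.
Proof.
elim: l => [|i l IH] mA; first by rewrite !big_nil measure0.
have [|mU le] := IH; first by move=> j jl; apply: mA; rewrite inE jl orbT.
have mi : measurable (A i) by apply: mA; rewrite mem_head.
rewrite !big_cons; split; first exact: measurableU.
by apply: le_trans (leeD2l _ le); apply: measureU2.
Qed.

Lemma vol_bigcup_ge (R : realType) (I : choiceType) (l : seq I) (A : I -> set (R * R * R)) :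
    uniq l -> (forall i, i \in l -> measurable (A i)) ->
    (forall i j, i \in l -> j \in l -> A i `&` A j !=set0 -> i = j) ->
  volume (\big[setU/set0]_(i <- l) A i) = (\sum_(i <- l) volume (A i))%E.
Proof.
elim: l => [|i l IH] /=; first by rewrite !big_nil measure0.
move=> /andP[il ul] mA dA.
have mi : measurable (A i) by apply: mA; rewrite mem_head.
have mAl j : j \in l -> measurable (A j) by move=> jl; apply: mA; rewrite inE jl orbT.
have [mU _] := vol_bigcup_le mAl.
rewrite !big_cons measureU //; last first.
  apply/seteqP; split=> // p [pi]; rewrite -bigcup_seq => -[j jl pj].
  have ij : i = j.
    by apply: dA; rewrite ?mem_head ?inE ?(jl : j \in l) ?orbT //; exists p.
  by rewrite ij (jl : j \in l) in il.
congr (_ + _)%E; apply: IH => // j k jl kl; apply: dA; rewrite inE ?jl ?kl orbT //.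
Qed.

(** The facets cover the polytope and their open hulls are disjoint, so its
    volume lies between two sums that are equal. *)
Lemma nvol_polytope_facets (R : realType) (w : seq int) : admissible bases w ->
  nvol (polytope R) =
  (sumn [seq tet_volume b | b <- facets (nonfaces w)])%:R%:E.
Proof.
move=> gw; pose F := facets (nonfaces w).
have triT := complex_triangulation R gw.
have bF b : b \in F -> b \in bases /\ set_of b \in complex (nonfaces w).
  by rewrite facetsP => /andP.
have nb b : b \in F -> mask_of (set_of b) \in bases.
  by move=> /bF[bb _]; rewrite (mask_ofK (bases_masks bb)).
pose H b := @forget_w R @` hull R (set_of b).
pose O b := @forget_w R @` open_hull R (set_of b).
have mH b : b \in F -> measurable (H b) by move=> /nb/(nvol_basis R)[].
have mO b : b \in F -> measurable (O b) by move=> /nb/(nvol_basis R)[].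
have coverH : @forget_w R @` polytope R = \big[setU/set0]_(b <- F) H b.
  rewrite -bigcup_seq; apply/seteqP; split=> y.
    move=> [x xP <-]; have [s sT xs] := complex_cover w xP.
    have /andP[_ pw] := gw; have [t [tb tT st]] := pure_basis pw sT.
    exists (mask_of t); first by rewrite /= facetsP tb set_ofK.
    by exists x => //; rewrite set_ofK; apply: hullS xs.
  move=> [b _ [x xb <-]]; exists x => //; apply: hullS xb.
  by apply/fintype.subsetP => i; rewrite inE.
have [mU leU] := vol_bigcup_le mH.
have uF : uniq F by exact: filter_uniq bases_uniq.
have disjO b c : b \in F -> c \in F -> O b `&` O c !=set0 -> b = c.
  move=> bF' cF' [_ [[x xb <-] [y yc xy]]].
  have exy : x = y.
    by apply: forget_w_inj (hull_sum (open_hull_sub xb))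
      (hull_sum (open_hull_sub yc)) (esym xy).
  have [bb bT] := bF b bF'; have [cb cT] := bF c cF'.
  rewrite -(mask_ofK (bases_masks bb)) -(mask_ofK (bases_masks cb)).
  congr mask_of; apply/eqP; rewrite eqEcard !card_basis ?nb // leqnn andbT.
  by apply: open_hull_sub_face triT bT cT xb _; rewrite exy; apply: open_hull_sub.
have eO := vol_bigcup_ge uF mO disjO.
have [mUO _] := vol_bigcup_le mO.
have eHO : (\sum_(b <- F) volume (O b) = \sum_(b <- F) volume (H b))%E.
  rewrite [LHS]big_seq [RHS]big_seq; apply: eq_bigr => b /nb bb.
  by have [_ _ _ ->] := nvol_basis R bb.
have volP : volume (@forget_w R @` polytope R) = (\sum_(b <- F) volume (H b))%E.
  apply/eqP; rewrite eq_le coverH leU -eHO -eO /=.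
  apply: le_measure; [exact: mem_set|exact: mem_set|].
  rewrite -!bigcup_seq => y [b bF' [x xb <-]].
  by exists b; [exact: bF'|exists x; [exact: open_hull_sub|]].
transitivity ((3`!)%:R%:E * volume (@forget_w R @` polytope R))%E; first by [].
rewrite volP ge0_sume_distrr; last by move=> b _; apply: measure_ge0.
rewrite sumnE big_map natr_sum -sumEFin [LHS]big_seq [RHS]big_seq.
apply: eq_bigr => b bF'; exact: nvol_facet bF'.
Qed.

End Volumes.

(** * Stanley-Reisner ideals and the classification *)

Lemma ideal_gen_sub (A : comNzRingType) (S S' : set A) :
    (forall g, S g -> exists2 g', S' g' & exists c, g = c * g') ->
  (ideal_gen S `<=` ideal_gen S')%classic.
Proof.
move=> SS' p [n [c [g [Sg ->]]]].
have /boolp.choice[h Hh] i : exists gc : A * A, S' gc.1 /\ g i = gc.2 * gc.1.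
  by have [g' S'g' [d gd]] := SS' _ (Sg i); exists (g', d).
exists n, (fun i => c i * (h i).2), (fun i => (h i).1); split=> [i|].
  by have [] := Hh i.
by apply: eq_bigr => i _; rewrite -mulrA; have [_ <-] := Hh i.
Qed.

(** Each generator of either ideal is a multiple of a generator of the other:
    a non-face contains a listed non-face, and listed sets are non-faces. *)
Lemma sr_ideal_complex (K : fieldType) (l : seq {set 'I_8}) :
  sr_ideal K (complex (map mask_of l)) = monomial_ideal K l.
Proof.
have nonface s : s \notin complex (map mask_of l) <->
    exists2 t, t \in l & t \subset s.
  rewrite finset.in_set; split.
    rewrite /face negbK has_lazyE => /hasP[_ /mapP[t tl ->]].
    by rewrite submask_of; exists t.
  move=> [t tl ts]; apply/negP => /faceP/(_ _ (map_f mask_of tl)).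
  by rewrite submask_of ts.
rewrite /sr_ideal /monomial_ideal.
apply/seteqP; split; apply: ideal_gen_sub => _ [s /= sl <-].
  have [t tl ts] := (nonface s).1 sl.
  exists (sqfree_monomial K t); first by exists t.
  exists (sqfree_monomial K (s :\: t)%SET).
  rewrite /sqfree_monomial (big_setID t) /= mulrC; congr (_ * _).
  by rewrite (finset.setIidPr ts).
exists (sqfree_monomial K s); last by exists 1; rewrite mul1r.
by exists s => //=; apply/nonface; exists s.
Qed.

Lemma all_admissible (w : seq int) : w \in all_weights -> admissible bases w.
Proof. exact: (allP weights_checked). Qed.

Definition weight_complex (w : seq int) : {set {set 'I_8}} := complex (nonfaces w).

Lemma regular_triangulationsE (R : realType) :
  regular_triangulations R = [set T in map weight_complex all_weights].
Proof.
apply/setP => T; rewrite !finset.in_set; apply/asboolP/mapP => [[triT [w eT]]|].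
  by move: triT; rewrite eT => /regular_from_list[v vW ->]; exists v.
move=> [v /all_admissible gv ->]; split; first exact: complex_triangulation.
by exists (realw R v); rewrite complex_lower_faces.
Qed.

(** Decides unimodularity: see [unimodular_complex]. *)
Definition all_facets_unit (w : seq int) : bool :=
  all (fun b => tet_volume b == 1%N) (facets (nonfaces w)).

Definition unimodular_weights : seq (seq int) := [seq w <- all_weights | all_facets_unit w].

Lemma unimodular_triangulationsE (R : realType) :
  unimodular_triangulations R = [set T in map weight_complex unimodular_weights].
Proof.
apply/setP => T; rewrite [LHS]finset.in_set [RHS]finset.in_set.
rewrite regular_triangulationsE finset.in_set.
apply/andP/mapP => [[/mapP[w wW ->] /asboolP uw]|[w]].
  exists w; last by [].
  rewrite mem_filter wW andbT; apply/(unimodular_complex R) => //.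
  exact: all_admissible.
rewrite mem_filter => /andP[uw wW] ->; split; first exact: map_f.
by apply/asboolP/unimodular_complex => //; apply: all_admissible.
Qed.

Lemma card_complexes (l : seq (seq int)) :
  #|[set T in map weight_complex l]| =
  size (undup [seq code (nonfaces w) | w <- l]).
Proof.
rewrite card_set_codes -map_comp; congr (size (undup _)).
by apply: eq_map => w /=; rewrite face_code_complex.
Qed.

(** Orbits are equal once one of them contains a member of the other. *)
Lemma orbit_eq_code (v w : seq int) :
  (sym_orbit (weight_complex v) == sym_orbit (weight_complex w)) =
  (code (nonfaces v) \in orbit_codes (nonfaces w)).
Proof.
rewrite -face_code_complex -sym_orbit_codes; apply/eqP/idP => [<-|].
  exact: orbit_refl.
by move/orbit_eqP.
Qed.

(** The codes of the orbits of [r] are computed once and for all. *)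
Definition orbits_cover (r l : seq (seq int)) : bool :=
  all (mem (flatten [seq orbit_codes (nonfaces w) | w <- r]))
    [seq code (nonfaces v) | v <- l].

Lemma sym_classesE (l r : seq (seq int)) : {subset r <= l} ->
    orbits_cover r l ->
  sym_classes [set T in map weight_complex l] =
  [set C in [seq sym_orbit (weight_complex w) | w <- r]].
Proof.
move=> rl; rewrite /orbits_cover all_map => /allP lr; apply/setP => C; rewrite [RHS]finset.in_set.
apply/imsetP/mapP => [[T]|[w wr ->]]; last first.
  exists (weight_complex w); last by [].
  by rewrite finset.in_set; apply: map_f; apply: rl.
rewrite finset.in_set => /mapP[v vl ->] ->; have /flatten_mapP[w wr vw] := lr v vl.
by exists w; [exact: wr|apply/eqP; rewrite orbit_eq_code; exact: vw].
Qed.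

Lemma card_orbits (r : seq (seq int)) :
    pairwise (fun v w => code (nonfaces v) \notin orbit_codes (nonfaces w)) r ->
  #|[set C in [seq sym_orbit (weight_complex w) | w <- r]]| = size r.
Proof.
move=> pr; rewrite card_set_seq undup_id ?size_map // uniq_pairwise pairwise_map.
apply: sub_pairwise pr => v w /=; by rewrite orbit_eq_code.
Qed.

Lemma counts_checked : [/\ size (undup [seq code (nonfaces w) | w <- all_weights]) = 70%N,
  size (undup [seq code (nonfaces w) | w <- unimodular_weights]) = 53%N,
  all (mem all_weights) reps && all (mem unimodular_weights) unimodular_reps,
  orbits_cover reps all_weights & orbits_cover unimodular_reps unimodular_weights].
Proof. by split; vm_compute. Qed.

Lemma reps_distinct :
  pairwise (fun v w => code (nonfaces v) \notin orbit_codes (nonfaces w)) reps.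
Proof. by vm_compute. Qed.

Lemma unimodular_reps_distinct :
  pairwise (fun v w => code (nonfaces v) \notin orbit_codes (nonfaces w)) unimodular_reps.
Proof. by have := reps_distinct; rewrite pairwise_cat => /and3P[]. Qed.

Lemma size_reps : size reps = 14%N. Proof. by vm_compute. Qed.

Lemma size_unimodular_reps : size unimodular_reps = 10%N. Proof. by vm_compute. Qed.

(** The squarefree monomials of the ten Stanley-Reisner ideals, labels being
    replaced by their ranks. *)
Definition table_gens : seq (seq (seq nat)) :=
  [:: [:: [:: 0; 7]; [:: 1; 6]; [:: 2; 5]; [:: 3; 4]; [:: 4; 6]; [:: 4; 7];
          [:: 5; 6]; [:: 5; 7]];
      [:: [:: 0; 1]; [:: 0; 2]; [:: 0; 7]; [:: 2; 3]; [:: 2; 5]; [:: 4; 7];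
          [:: 5; 6]; [:: 5; 7]];
      [:: [:: 0; 1]; [:: 0; 7]; [:: 1; 6]; [:: 2; 5]; [:: 4; 6]; [:: 4; 7];
          [:: 5; 6]; [:: 5; 7]];
      [:: [:: 0; 1]; [:: 0; 2]; [:: 0; 7]; [:: 1; 2]; [:: 1; 6]; [:: 2; 5];
          [:: 5; 6]; [:: 5; 7]; [:: 4; 6; 7]];
      [:: [:: 0; 1]; [:: 0; 2]; [:: 0; 3]; [:: 0; 7]; [:: 1; 2]; [:: 2; 3];
          [:: 2; 5]; [:: 5; 7]; [:: 1; 5; 6]; [:: 3; 4; 7]];
      [:: [:: 0; 1]; [:: 0; 2]; [:: 0; 3]; [:: 0; 7]; [:: 1; 2]; [:: 1; 3];
          [:: 1; 6]; [:: 2; 5]; [:: 4; 6; 7]; [:: 5; 6; 7]];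
      [:: [:: 0; 1]; [:: 0; 2]; [:: 0; 7]; [:: 1; 6]; [:: 2; 5]; [:: 4; 7];
          [:: 5; 6]; [:: 5; 7]];
      [:: [:: 0; 1]; [:: 0; 2]; [:: 0; 3]; [:: 0; 7]; [:: 1; 6]; [:: 2; 5];
          [:: 4; 7]; [:: 5; 7]];
      [:: [:: 0; 1]; [:: 0; 2]; [:: 0; 3]; [:: 0; 7]; [:: 2; 3]; [:: 2; 5];
          [:: 4; 7]; [:: 5; 7]; [:: 1; 5; 6]];
      [:: [:: 0; 1]; [:: 0; 2]; [:: 0; 3]; [:: 0; 7]; [:: 1; 2]; [:: 1; 6];
          [:: 2; 5]; [:: 5; 7]; [:: 4; 6; 7]]]%N.

Definition set_list (l : seq nat) : {set 'I_8} := [set i : 'I_8 | (i : nat) \in l].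

Lemma set2_list (i j : 'I_8) : [set i; j] = set_list [:: (i : nat); (j : nat)].
Proof. by apply/setP => k; rewrite !inE. Qed.

Lemma set3_list (i j k : 'I_8) :
  [set i; j; k] = set_list [:: (i : nat); (j : nat); (k : nat)].
Proof. by apply/setP => x; rewrite !inE orbA. Qed.

Lemma sr_generatorsE (k : 'I_10) : sr_generators (tnth class_table k) =
  [seq set_list l | l <- nth [::] table_gens k].
Proof.
rewrite (tnth_nth (tnth class_table k)).
by case: k => -[|[|[|[|[|[|[|[|[|[|//]]]]]]]]]] /= _; rewrite !(set2_list, set3_list).
Qed.

Definition table_gkz : seq (seq nat) :=
  [:: [:: 5; 5; 5; 5; 2; 2; 2; 2]; [:: 2; 5; 2; 5; 5; 2; 5; 2];
      [:: 3; 3; 5; 7; 4; 2; 2; 2]; [:: 2; 2; 3; 7; 6; 2; 3; 3];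
      [:: 1; 4; 1; 4; 6; 3; 6; 3]; [:: 1; 1; 3; 5; 6; 4; 4; 4];
      [:: 2; 3; 4; 7; 5; 2; 3; 2]; [:: 1; 3; 4; 6; 5; 3; 4; 2];
      [:: 1; 5; 2; 4; 5; 3; 6; 2]; [:: 1; 2; 3; 6; 6; 3; 4; 3]]%N.

Definition table_orbits : seq nat := [:: 1; 4; 4; 4; 4; 4; 8; 8; 8; 8]%N.

Lemma class_tableE (k : 'I_10) : let D := tnth class_table k in
  [/\ orbit_size D = nth 0%N table_orbits k,
      weights D = nth [::] table_weights k
    & gkz_coords D = nth [::] table_gkz k].
Proof.
rewrite /= (tnth_nth (tnth class_table k)).
by case: k => -[|[|[|[|[|[|[|[|[|[|//]]]]]]]]]].
Qed.

Definition table_rep (k : nat) : seq int := nth [::] unimodular_reps k.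

Lemma weight_table_rep (R : realType) (k : 'I_10) : weight R k = realw R (table_rep k).
Proof.
apply/funext => j; rewrite /weight /realw /table_rep.
have [_ -> _] := class_tableE k.
have -> : nth [::] unimodular_reps k = int_weights (nth [::] table_weights k).
  by rewrite (nth_map [::]) //; exact: ltn_ord.
have [jw|wj] := ltnP j (size (nth [::] table_weights k)).
  by rewrite (nth_map 0%N) // pmulrn.
by rewrite (nth_default 0%N wj) nth_default ?size_map.
Qed.

Definition mask_list (l : seq nat) : bitseq := mkseq (fun k => k \in l) 8.

Lemma mask_set_list (l : seq nat) : mask_of (set_list l) = mask_list l.
Proof.
apply: (@eq_from_nth _ false) => [|k]; first by rewrite !size_mkseq.
by rewrite size_mkseq => k8; rewrite !nth_mkseq // inE inordK.
Qed.

Lemma table_checked : all (fun k =>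
  [&& table_rep k \in unimodular_weights,
      size (undup (orbit_codes (nonfaces (table_rep k)))) ==
        nth 0%N table_orbits k,
      code (nonfaces (table_rep k)) == code (map mask_list (nth [::] table_gens k)) &
      all (fun j => sumn [seq tet_volume b | b <- facets (nonfaces (table_rep k)) & nth false b j]
         == nth 0%N (nth [::] table_gkz k) j) (iota 0 8)]) (iota 0 10).
Proof. by vm_compute. Qed.

Lemma facet_volumes_sum :
  sumn [seq tet_volume b | b <- facets (nonfaces (table_rep (@ord0 9)))] = 7%N.
Proof. by vm_compute. Qed.

Lemma table_row (k : 'I_10) :
  [&& table_rep k \in unimodular_weights,
      size (undup (orbit_codes (nonfaces (table_rep k)))) == nth 0%N table_orbits k,
      code (nonfaces (table_rep k)) == code (map mask_list (nth [::] table_gens k)) &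
      all (fun j => sumn [seq tet_volume b | b <- facets (nonfaces (table_rep k)) & nth false b j]
         == nth 0%N (nth [::] table_gkz k) j) (iota 0 8)].
Proof.
by apply: (allP table_checked k); rewrite mem_iota leq0n; exact: ltn_ord k.
Qed.

Lemma table_rep_unimodular (k : 'I_10) : table_rep k \in unimodular_weights.
Proof. by case/and4P: (table_row k). Qed.

Lemma table_rep_admissible (k : 'I_10) : admissible bases (table_rep k).
Proof.
apply: all_admissible; have := table_rep_unimodular k; rewrite mem_filter => /andP[_]; exact.
Qed.

Lemma lower_faces_weight (R : realType) (k : 'I_10) :
  lower_faces (weight R k) = weight_complex (table_rep k).
Proof. rewrite weight_table_rep; exact: complex_lower_faces (table_rep_admissible k). Qed.

Lemma nvol_polytope (R : realType) : nvol (polytope R) = 7%:R%:E.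
Proof. by rewrite (nvol_polytope_facets R (table_rep_admissible ord0)) facet_volumes_sum. Qed.

Lemma card_regular (R : realType) : #|regular_triangulations R| = 70%N.
Proof.
have [c70 _ _ _ _] := counts_checked.
by rewrite regular_triangulationsE card_complexes c70.
Qed.

Lemma card_unimodular (R : realType) : #|unimodular_triangulations R| = 53%N.
Proof.
have [_ c53 _ _ _] := counts_checked.
by rewrite unimodular_triangulationsE card_complexes c53.
Qed.

Lemma card_regular_classes (R : realType) :
  #|sym_classes (regular_triangulations R)| = 14%N.
Proof.
have [_ _ /andP[/allP sub _] cov _] := counts_checked.
rewrite regular_triangulationsE (sym_classesE sub cov).
by rewrite (card_orbits reps_distinct) size_reps.
Qed.

Lemma unimodular_classes (R : realType) :
  sym_classes (unimodular_triangulations R) =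
  [set C in [seq sym_orbit (weight_complex w) | w <- unimodular_reps]].
Proof.
have [_ _ /andP[_ /allP sub] _ cov] := counts_checked.
by rewrite unimodular_triangulationsE (sym_classesE sub cov).
Qed.

Lemma card_unimodular_classes (R : realType) :
  #|sym_classes (unimodular_triangulations R)| = 10%N.
Proof.
by rewrite unimodular_classes (card_orbits unimodular_reps_distinct) size_unimodular_reps.
Qed.

Lemma unimodular_classes_table (R : realType) :
  sym_classes (unimodular_triangulations R) =
  [set sym_orbit (lower_faces (weight R k)) | k : 'I_10].
Proof.
rewrite unimodular_classes; apply/setP => C; rewrite finset.in_set.
apply/mapP/imsetP => [[w wr ->]|[k _ ->]].
  have wlt : (index w unimodular_reps < 10)%N by rewrite -size_unimodular_reps index_mem.
  exists (Ordinal wlt) => [|]; first exact: isT.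
  by rewrite lower_faces_weight /table_rep (nth_index _ wr).
exists (table_rep k); last by rewrite lower_faces_weight.
apply: mem_nth; rewrite size_unimodular_reps; exact: ltn_ord.
Qed.

Theorem theorem2p5 (R : realType) (K : fieldType) :
  [/\ vertices (polytope R) = range (pt R),
      has_dim (polytope R) 3
    & nvol (polytope R) = 7%:R%:E] /\
  (#|regular_triangulations R| = 70%N /\
   #|sym_classes (regular_triangulations R)| = 14%N) /\
  (#|unimodular_triangulations R| = 53%N /\
   #|sym_classes (unimodular_triangulations R)| = 10%N) /\
  sym_classes (unimodular_triangulations R) =
    [set sym_orbit (lower_faces (weight R k)) | k : 'I_10] /\
  (forall k : 'I_10,
     let T := lower_faces (weight R k) in
     let D := tnth class_table k in
     [/\ T \in unimodular_triangulations R,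
         #|sym_orbit T| = orbit_size D,
         sr_ideal K T = monomial_ideal K (sr_generators D)
       & forall j : 'I_8, gkz R T j = ((nth 0%N (gkz_coords D) j)%:R)%:E]).
Proof.
split; first split.
- exact: vertices_polytope.
- exact: has_dim_polytope.
- exact: nvol_polytope.
split; first by rewrite card_regular card_regular_classes.
split; first by rewrite card_unimodular card_unimodular_classes.
split; first exact: unimodular_classes_table.
move=> k T D; have [orb _ gkzD] := class_tableE k.
have /and4P[_ /eqP orbit_k /eqP gens_k /allP gkz_k] := table_row k.
rewrite /T lower_faces_weight; split.
- rewrite unimodular_triangulationsE finset.in_set; apply: map_f; exact: table_rep_unimodular.
- by rewrite card_sym_orbit orbit_k orb.
- rewrite sr_generatorsE -sr_ideal_complex; congr sr_ideal.
  apply: face_code_inj; rewrite !face_code_complex gens_k -map_comp.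
  by congr code; apply: eq_map => l /=; rewrite mask_set_list.
- move=> j; rewrite (gkz_complex R j (table_rep_admissible k)) gkzD.
  have j8 : (j : nat) \in iota 0 8 by rewrite mem_iota leq0n; exact: ltn_ord.
  by rewrite (eqP (gkz_k j j8)).
Qed.
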